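(* There is a universal constant $C>0$ such that the following holds. Let $\alpha>0$, $p\ge 1$, $r\ge 1$, $0<\omega<1$, $\tau_0>0$, $R>0$. Let $U\in\mathrm{SO}(3)$, let $e_z=(0,0,1)$, $v=Ue_z$, and let $\theta\in[0,\pi)$ be the angle between $e_z$ and $v$. Let $f:\mathbb{R}^3\to\mathbb{R}$ be in $L^1\cap L^r$, with $\|f\|_{M^r}<\infty$, and supported on the ball $B(0,R)$ of radius $R$ centered at the origin, and let $f_U(x)=f(Ux)$. Suppose $\tau_0\ge(2R\sin(\theta/2))^2$. Then $$\mathrm{D}_{\alpha,p,r}(\mathcal{P}f,\ \mathcal{P}f_U;\ \mathrm{SO}(2))\ \le\ C\cdot\|f\|_{M^r}\cdot\frac{\tau_0^{\alpha/2}}{1-\omega^{1/2}}\cdot\Delta_{\alpha,p}\big(2R\sin(\theta/2)/\sqrt{\tau_0}\big).$$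
   Context: $\mathcal{P}$ is the tomographic projection onto the $xy$-plane: $(\mathcal{P}f)(x,y)=\int_{\mathbb{R}} f(x,y,z)\,dz$. Max-mixed norm: for a $2$-dimensional subspace $\mathcal{U}\subset\mathbb{R}^3$, writing points of $\mathbb{R}^3$ as $(x,y)$ with $x\in\mathcal{U}$, $y\in\mathcal{U}^\perp$, $\|f\|_{M^r(\mathcal{U})}=\Big(\int_{\mathcal{U}}\big(\int_{\mathcal{U}^\perp}|f(x,y)|\,dy\big)^r dx\Big)^{1/r}$, and $\|f\|_{M^r}=\sup_{\dim\mathcal{U}=2}\|f\|_{M^r(\mathcal{U})}$. Scale-space metric on $\mathbb{R}^2$: $G_\tau(x)=(\pi\tau)^{-1}e^{-|x|^2/\tau}$, $\tau_k=\tau_0\omega^k$ for $k\ge 0$, and for $u,w\in L^r(\mathbb{R}^2)$, $$\mathrm{D}_{\alpha,p,r}(u,w)=\Big(\sum_{k\ge 0}\tau_k^{p\alpha/2}\,\|G_{\tau_k}*(u-w)\|_{L^r}^p\Big)^{1/p},\qquad \mathrm{D}_{\alpha,p,r}(u,w;\mathrm{SO}(2))=\min_{Q\in\mathrm{SO}(2)}\mathrm{D}_{\alpha,p,r}(u,w\circ Q).$$ The function $\Delta_{\alpha,p}$: for $0<\epsilon\le 1$, $$\Delta_{\alpha,p}(\epsilon)=\begin{cases}\epsilon^\alpha/(\alpha-\alpha^2)^{1/p}, & 0<\alpha<1,\\ \epsilon\,(\log(1/\epsilon)+1)^{1/p}, & \alpha=1,\\ \epsilon/\min\{(\alpha-1)^{1/p},1\},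 & \alpha>1,\end{cases}$$ and $\Delta_{\alpha,p}(0)=0$. *)

(* Defs.v *)
From HB Require Import structures.
From mathcomp Require Import all_boot all_order all_algebra.
From mathcomp Require Import all_classical all_reals all_analysis.
Set Implicit Arguments.
Unset Strict Implicit.
Unset Printing Implicit Defensive.
Import Order.TTheory GRing.Theory Num.Theory.
Import numFieldNormedType.Exports.
Local Open Scope classical_set_scope.
Local Open Scope ring_scope.

(* R^2 and R^3 are iterated products, so that the library's product measures
   and Fubini theorems apply.  The canonical norm on these products is the sup
   norm; the Euclidean norms are defined explicitly below. *)
Notation R2 R := (measurableTypeR R * measurableTypeR R)%type.
Notation R3 R := (measurableTypeR R * measurableTypeR R * measurableTypeR R)%type.

Section Coordinates.
Context {R : realType}.

Definition col2 (x : R2 R) : 'cV[R]_2 := \col_(i < 2) [:: x.1; x.2]`_i.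
Definition pt2 (c : 'cV[R]_2) : R2 R := (c 0 0, c 1 0).

Definition col3 (x : R3 R) : 'cV[R]_3 := \col_(i < 3) [:: x.1.1; x.1.2; x.2]`_i.
Definition pt3 (c : 'cV[R]_3) : R3 R := (c 0 0, c 1 0, c 2 0).

Definition app2 (A : 'M[R]_2) (x : R2 R) : R2 R := pt2 (A *m col2 x).
Definition app3 (A : 'M[R]_3) (x : R3 R) : R3 R := pt3 (A *m col3 x).

Definition dot3 (x y : R3 R) : R := x.1.1 * y.1.1 + x.1.2 * y.1.2 + x.2 * y.2.
Definition enorm2 (x : R2 R) : R := Num.sqrt (x.1 ^+ 2 + x.2 ^+ 2).
Definition enorm3 (x : R3 R) : R := Num.sqrt (dot3 x x).
Definition angle3 (x y : R3 R) : R := acos (dot3 x y / (enorm3 x * enorm3 y)).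

Definition ez : R3 R := (0, 0, 1).

End Coordinates.

Definition SO {R : realType} (n : nat) : set 'M[R]_n :=
  [set A | A *m A^T = 1%:M /\ \det A = 1].

Definition leb1 (R : realType) : {measure set (measurableTypeR R) -> \bar R} :=
  @lebesgue_measure R.
Definition leb2 (R : realType) : {measure set (R2 R) -> \bar R} :=
  (@lebesgue_measure R \x @lebesgue_measure R)%E.
Definition leb3 (R : realType) : {measure set (R3 R) -> \bar R} :=
  ((@lebesgue_measure R \x @lebesgue_measure R) \x @lebesgue_measure R)%E.

Section MixedNorm.
Context {R : realType}.

Definition proj_xy (f : R3 R -> R) (x : R2 R) : R :=
  \int[leb1 R]_z f (x, z).

(* For U of dimension 2, these are the orthogonal matrices whose columns 0, 1
   form an orthonormal basis of U; column 2 is then a unit vector spanning the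
   orthogonal complement of U. *)
Definition adapted_frames (U : {vspace 'cV[R]_3}) : set 'M[R]_3 :=
  [set B | B^T *m B = 1%:M /\ <<[:: col 0%R B; col 1%R B]>>%VS = U].

Definition mixed_norm_in (r : R) (f : R3 R -> R) (B : 'M[R]_3) : \bar R :=
  (Lnorm (leb2 R) r%:E (fun x => \int[leb1 R]_z `|f (app3 B (x, z))|%:E))%E.

(* The Lebesgue measures on U and on its orthogonal complement are read in
   orthonormal coordinates.  The value does not depend on the adapted frame B,
   so the supremum over B is only a way not to choose one. *)
Definition mixed_norm (r : R) (f : R3 R -> R) (U : {vspace 'cV[R]_3}) : \bar R :=
  ereal_sup [set mixed_norm_in r f B | B in adapted_frames U].

Definition max_mixed_norm (r : R) (f : R3 R -> R) : \bar R :=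
  ereal_sup [set mixed_norm r f U | U in [set U | \dim U = 2%N]].

End MixedNorm.

Section ScaleSpace.
Context {R : realType}.

Definition gauss2 (tau : R) (x : R2 R) : R :=
  (pi * tau)^-1 * expR (- (enorm2 x ^+ 2 / tau)).

Definition conv2 (g h : R2 R -> R) (x : R2 R) : R :=
  \int[leb2 R]_y (g (x.1 - y.1, x.2 - y.2) * h y).

Definition scale_dist (tau0 omega alpha p r : R) (u w : R2 R -> R) : \bar R :=
  ((\sum_(0 <= k <oo)
      ((tau0 * omega ^+ k) `^ (p * alpha / 2))%:E *
      'N[leb2 R]_(r%:E)[EFin \o conv2 (gauss2 (tau0 * omega ^+ k))
                                      (fun x => u x - w x)%R] `^ p)
   `^ p^-1)%E.

(* The minimum over SO(2) is written as an infimum; for integrable u and w it is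
   attained, SO(2) being compact and the distance lower semicontinuous in Q. *)
Definition scale_dist_SO2 (tau0 omega alpha p r : R) (u w : R2 R -> R) : \bar R :=
  ereal_inf [set scale_dist tau0 omega alpha p r u (w \o app2 Q)
            | Q in @SO R 2].

Definition Delta (alpha p eps : R) : R :=
  if eps == 0 then 0
  else if alpha < 1 then eps `^ alpha / (alpha - alpha ^+ 2) `^ p^-1
  else if alpha == 1 then eps * (ln eps^-1 + 1) `^ p^-1
  else eps / Num.min ((alpha - 1) `^ p^-1) 1.

End ScaleSpace.

(* Main.v *)
Require Import Defs.
From HB Require Import structures.
From mathcomp Require Import all_boot all_order all_algebra.
From mathcomp Require Import all_classical all_reals all_analysis.
From mathcomp Require Import measurable_realfun ring lra.
Import Order.TTheory GRing.Theory Num.Theory.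
Import numFieldNormedType.Exports.
Local Open Scope classical_set_scope.
Local Open Scope ring_scope.

(* Let V be the minimal rotation taking e_z to v = U e_z.  It differs from U by
   a rotation about the z-axis, so for a suitable Q in SO(2) the function
   (P f_U) o Q is P f_V.  A point y of the ball of radius R satisfies
   |P y - P V^T y| <= d := 2 R sin(theta/2).

   After the change of variables y -> V^T y,
     (G_t * (P f - P f_V))(x) = int f(y) (G_t(x - P y) - G_t(x - P V^T y)) dy.
   If d <= sqrt t, then |G_t(p) - G_t(q)| <= 64 (d / sqrt t) G_{4t}(p) whenever
   |p - q| <= d, so the convolution is dominated by 64 (d / sqrt t) G_{4t} * P|f|.
   Young's inequality bounds its L^r norm by 64 (d / sqrt t) ||f||_{M^r}; if
   d > sqrt t, the triangle inequality gives 4 ||f||_{M^r}.  It remains to sum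
   the terms tau_k^{p alpha/2} min(1, d / sqrt tau_k)^p, which form a growing or
   decaying geometric series on either side of sqrt tau_k = d.

   Lebesgue measure is invariant under V because V is a product of three shears,
   as a plane rotation is. *)

(** * The sum over scales *)

Section GeometricSums.
Context {R : realType}.
Implicit Types (q s p alpha eps x y : R) (F Phi : R -> R).

(* Telescoping: [Phi x] bounds the sum of [F] along [x, q x, q^2 x, ...]. *)
Lemma sum_le_potential q F Phi : 0 < q ->
    (forall x, 0 < x -> 0 <= Phi x) ->
    (forall x, 0 < x -> F x + Phi (q * x) <= Phi x) ->
  forall n x, 0 < x -> \sum_(k < n) F (q ^+ k * x) <= Phi x.
Proof.
move=> q0 Phi0 step; elim=> [|n IH] x x0; first by rewrite big_ord0 Phi0.
rewrite big_ord_recl expr0 mul1r; apply: le_trans (step _ x0); rewrite lerD2l.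
apply: le_trans (IH (q * x) (mulr_gt0 q0 x0)).
rewrite le_eqVlt; apply/orP; left; apply/eqP/eq_bigr => i _.
by rewrite exprS mulrCA mulrA.
Qed.

(** Bernoulli's inequality. For [s < 1], Young's inequality with exponents [1/s] and [1/(1 - s)]
    applied to [q^s] and [1] gives [q^s <= s q + (1 - s)]; for [s >= 1] simply [q^s <= q]. *)
Lemma powR_bernoulli q s : 0 < q < 1 -> 0 < s ->
  (1 - q) * Num.min s 1 <= 1 - q `^ s.
Proof.
move=> /andP[q0 q1] s0; have [s1|s1] := ltP s 1; last first.
  rewrite mulr1 lerD2l lerN2 -[leRHS](@powRr1 _ q) ?(ltW q0)//.
  by apply: ger_powR; rewrite ?q0 ?(ltW q1).
have := @conjugate_powR R (q `^ s) 1 s^-1 (1 - s)^-1 (powR_ge0 _ _) ler01.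
rewrite !invr_gt0 !invrK powR1 -powRrM mulfV ?gt_eqF// (powRr1 (ltW q0)).
move=> /(_ s0); rewrite subr_gt0 => /(_ s1).
rewrite subrKC => /(_ erefl); lra.
Qed.

Lemma powR_lt1 q s : 0 < q < 1 -> 0 < s -> q `^ s < 1.
Proof.
move=> q01 s0; rewrite -subr_gt0.
apply: lt_le_trans (powR_bernoulli q s q01 s0).
by rewrite mulr_gt0 ?subr_gt0 ?lt_min ?s0 ?ltr01//; case/andP: q01.
Qed.

(** The terms below [eps] form a geometric series of ratio [q^s] whose first term is less than
    [eps^s]. The potential stays constant while [x] is far above [eps], where nothing is summed
    yet. *)
Lemma sum_powR_below q s eps n : 0 < q < 1 -> 0 < s -> 0 < eps ->
  \sum_(k < n) (if q ^+ k < eps then (q ^+ k) `^ s else 0)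
    <= eps `^ s / (1 - q `^ s).
Proof.
move=> q01 s0 e0; have [q0 q1] := andP q01; have rho1 := powR_lt1 q s q01 s0.
pose F x := if x < eps then x `^ s else 0.
pose Phi x := (Num.min x eps) `^ s / (1 - q `^ s).
have den : 0 < 1 - q `^ s by rewrite subr_gt0.
have := @sum_le_potential q F Phi q0.
move=> /(_ _ _ n 1 ltr01); rewrite /F /Phi.
under eq_bigr do rewrite mulr1.
move=> H; apply: le_trans (H _ _) _.
- by move=> x x0; rewrite divr_ge0 ?powR_ge0 ?(ltW den).
- move=> x x0; case: ltP => xe.
    rewrite min_l; last by rewrite (le_trans _ (ltW xe))// ler_piMl ?(ltW x0) ?(ltW q1).
    rewrite powRM ?(ltW q0) ?(ltW x0)// -[X in X + _](mulfK (lt0r_neq0 den))//.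
    by rewrite -mulrDl ler_pM2r ?invr_gt0//; lra.
  rewrite add0r ler_pM2r ?invr_gt0//.
  apply: ge0_ler_powR; rewrite ?nnegrE ?(ltW s0) ?(ltW e0)//.
    by rewrite le_min (ltW e0) mulr_ge0 ?ltW.
  by rewrite ge_min lexx orbT.
- rewrite ler_pM2r ?invr_gt0//.
  apply: ge0_ler_powR; rewrite ?nnegrE ?(ltW s0) ?(ltW e0)// ?le_min ?ler01 ?(ltW e0)//.
  by rewrite ge_min lexx orbT.
Qed.

(** The terms grow with [k] by the factor [q^(-s)], so the last one before [eps] is crossed, at most
    [eps^(-s)], controls the sum. *)
Lemma sum_powRN_above q s eps n : 0 < q < 1 -> 0 < s -> 0 < eps <= 1 ->
  \sum_(k < n) (if eps <= q ^+ k then (q ^+ k) `^ (- s) else 0)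
    <= eps `^ (- s) / (1 - q `^ s).
Proof.
move=> q01 s0 /andP[e0 e1]; have [q0 q1] := andP q01.
have rho1 := powR_lt1 q s q01 s0.
have den : 0 < 1 - q `^ s by rewrite subr_gt0.
pose F x := if eps <= x then x `^ (- s) else 0.
(* The closed form of the geometric sum from [x] down to the level [eps]; as long as [q x >= eps] it
   drops by exactly [x^(-s)] when [x] becomes [q x]. *)
pose Phi x := if eps <= x then
   (eps `^ (- s) - q `^ s * x `^ (- s)) / (1 - q `^ s) else 0.
have mono x : eps <= x -> x `^ (- s) <= eps `^ (- s).
  move=> ex; rewrite !powRN lef_pV2 ?posrE ?powR_gt0//; last exact: lt_le_trans ex.
  by apply: ge0_ler_powR; rewrite ?nnegrE ?(ltW s0) ?(ltW e0)// (le_trans (ltW e0)).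
have := @sum_le_potential q F Phi q0.
move=> /(_ _ _ n 1 ltr01); rewrite /F /Phi.
under eq_bigr do rewrite mulr1.
move=> H; apply: le_trans (H _ _) _.
- move=> x x0; case: ifP => // ex; rewrite divr_ge0 ?(ltW den)// subr_ge0.
  apply: le_trans (mono _ ex); rewrite ler_piMl ?powR_ge0// ltW//.
- move=> x x0; case: (leP eps x) => ex; last first.
    by rewrite add0r ifF// leNgt (lt_trans _ ex)// gtr_pMl.
  case: ifP => eqx.
    rewrite powRM ?(ltW q0) ?(ltW x0)// -[X in X + _](mulfK (lt0r_neq0 den))//.
    rewrite -mulrDl ler_pM2r ?invr_gt0// mulrA -powRD ?subrr ?powRr0.
      lra.
    by apply/implyP => _; rewrite gt_eqF.
  rewrite addr0 ler_pdivlMr//.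
  have := mono _ ex; lra.
- rewrite e1 powR1 mulr1 ler_pM2r ?invr_gt0//.
  by rewrite gerBl powR_ge0.
Qed.

(** Each step lowers [ln (x / eps)] by [- ln q >= 1 - q], so the logarithm limits the number of
    steps before [eps] is crossed. *)
Lemma count_above q eps n : 0 < q < 1 -> 0 < eps <= 1 ->
  \sum_(k < n) (if eps <= q ^+ k then 1 else 0)
    <= 1 + ln eps^-1 / (1 - q).
Proof.
move=> /andP[q0 q1] /andP[e0 e1].
pose F x : R := if eps <= x then 1 else 0.
pose Phi x := if eps <= x then 1 + ln (x / eps) / (1 - q) else 0.
have den : 0 < 1 - q by rewrite subr_gt0.
have lnq : ln q <= - (1 - q).
  by have := @le_ln1Dx _ (q - 1); rewrite subrKC opprB; apply; lra.
have := @sum_le_potential q F Phi q0.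
move=> /(_ _ _ n 1 ltr01); rewrite /F /Phi.
under eq_bigr do rewrite mulr1.
have ge0 x : eps <= x -> 0 <= ln (x / eps) / (1 - q).
  by move=> ex; rewrite divr_ge0 ?(ltW den)// ln_ge0// ler_pdivlMr// mul1r.
move=> H; apply: le_trans (H _ _) _.
- by move=> x x0; case: ifP => // ex; rewrite addr_ge0// ge0.
- move=> x x0; case: (leP eps x) => ex; last first.
    by rewrite add0r ifF// leNgt (lt_trans _ ex)// gtr_pMl.
  case: ifP => eqx; last by rewrite addr0 lerDl ge0.
  rewrite lerD2l -mulrA lnM ?posrE ?divr_gt0// -lerBrDr -mulrBl.
  rewrite ler_pdivlMr//; lra.
- by rewrite e1 mul1r.
Qed.

Lemma powR_min_split alpha p eps x : 0 < p -> 0 < eps -> 0 < x ->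
  (x `^ alpha * Num.min 1 (eps / x)) `^ p =
  eps `^ p * (if eps <= x then x `^ ((alpha - 1) * p) else 0) +
  (if x < eps then x `^ (alpha * p) else 0).
Proof.
move=> p0 e0 x0; case: ltP => xe.
  by rewrite mulr0 add0r min_l ?mulr1 ?powRrM// ler_pdivlMr// mul1r ltW.
rewrite addr0 min_r ?ler_pdivrMr ?mul1r//.
rewrite mulrBl mul1r powRB; last by apply/implyP => _; rewrite gt_eqF.
rewrite mulrCA powRM ?mulr_ge0 ?invr_ge0 ?powR_ge0 ?ltW//.
rewrite powRM ?invr_ge0 ?powR_ge0 ?ltW// powRrM; congr (_ * (_ * _)).
by rewrite -powR_inv1 ?(ltW x0)// -powRrM mulN1r powRN.
Qed.

Lemma scale_sum_split alpha p q eps n : 0 < p -> 0 < q -> 0 < eps ->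
  \sum_(k < n) ((q ^+ k) `^ alpha * Num.min 1 (eps / q ^+ k)) `^ p =
  eps `^ p * (\sum_(k < n)
    (if eps <= q ^+ k then (q ^+ k) `^ ((alpha - 1) * p) else 0)) +
  \sum_(k < n) (if q ^+ k < eps then (q ^+ k) `^ (alpha * p) else 0).
Proof.
move=> p0 q0 e0; rewrite mulr_sumr -big_split/=; apply: eq_bigr => k _.
by rewrite powR_min_split// exprn_gt0.
Qed.

Lemma geometric_sum_le q s n : 0 < q < 1 -> 0 < s ->
  \sum_(k < n) (q ^+ k) `^ s <= 1 / (1 - q `^ s).
Proof.
move=> q01 s0; have [q0 q1] := andP q01.
have den : 0 < 1 - q `^ s by rewrite subr_gt0 powR_lt1.
have := @sum_le_potential q (fun x => x `^ s) (fun x => x `^ s / (1 - q `^ s)).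
move=> /(_ q0 _ _ n 1 ltr01); rewrite powR1.
under eq_bigr do rewrite mulr1.
apply => [x x0|x x0]; first by rewrite divr_ge0 ?powR_ge0 ?(ltW den).
rewrite powRM ?(ltW q0) ?(ltW x0)// -[X in X + _](mulfK (lt0r_neq0 den))//.
by rewrite -mulrDl ler_pM2r ?invr_gt0//; lra.
Qed.

Lemma powR_bernoulliV q s u : 0 < q < 1 -> 0 < u -> u <= Num.min s 1 ->
  (1 - q `^ s)^-1 <= (u * (1 - q))^-1.
Proof.
move=> q01 u0; rewrite le_min => /andP[us u1].
have s0 : 0 < s by exact: lt_le_trans us.
have [q0 q1] := andP q01.
rewrite lef_pV2 ?posrE ?subr_gt0 ?powR_lt1// ?mulr_gt0 ?subr_gt0//.
apply: le_trans (powR_bernoulli q s q01 s0).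
by rewrite mulrC ler_pM2l ?subr_gt0// le_min us.
Qed.

Lemma powR_div_root p x y : 0 < p -> 0 <= x -> 0 <= y ->
  (x / y `^ p^-1) `^ p = x `^ p / y.
Proof.
move=> p0 x0 y0; rewrite powRM ?invr_ge0 ?powR_ge0//; congr (_ * _).
rewrite -(powR_inv1 (powR_ge0 _ _)) -!powRrM mulN1r mulrN mulVf ?gt_eqF//.
by rewrite powR_inv1.
Qed.

(** Here [q] stands for the square root of [omega]. Above [eps] the terms are powers of exponent
    [(alpha - 1) p], which grow, stay constant or decay with [k] according to the sign of
    [alpha - 1]; this produces the three branches of [Delta]. Bernoulli's inequality replaces every
    [1 - q^s] by a multiple of [1 - q]. *)
Lemma scale_sum_le_Delta_powR alpha p q eps n :
    0 < alpha -> 1 <= p -> 0 < q < 1 -> 0 < eps <= 1 ->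
  \sum_(k < n) ((q ^+ k) `^ alpha * Num.min 1 (eps / q ^+ k)) `^ p
    <= 2 * Delta alpha p eps `^ p / (1 - q).
Proof.
move=> a0 p1 q01 e01.
have [q0 q1] := andP q01; have [e0 e1] := andP e01.
have p0 : 0 < p by exact: lt_le_trans p1.
have ap0 : 0 < alpha * p by rewrite mulr_gt0.
have q1' : 0 < 1 - q by rewrite subr_gt0.
have ep0 : 0 <= eps `^ p by exact: powR_ge0.
rewrite scale_sum_split// /Delta (gt_eqF e0).
have below := sum_powR_below q (alpha * p) eps n q01 ap0 e0.
have [a1|a1|a1] := ltgtP alpha 1.
- have s0 : 0 < (1 - alpha) * p by rewrite mulr_gt0// subr_gt0.
  have above := sum_powRN_above q ((1 - alpha) * p) eps n q01 s0 e01.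
  rewrite -mulNr opprB in above.
  have a20 : 0 <= alpha - alpha ^+ 2.
    by rewrite subr_ge0 expr2 ler_piMr ?(ltW a0) ?(ltW a1).
  rewrite powR_div_root ?powR_ge0// -powRrM.
  (* The exponents are at least [alpha] and [1 - alpha], and [1/alpha + 1/(1 - alpha) = 1/(alpha -
     alpha^2)] is the denominator in the first branch of [Delta]. *)
  have A : (1 - q `^ (alpha * p))^-1 <= (alpha * (1 - q))^-1.
    apply: powR_bernoulliV => //; rewrite le_min (ltW a1) andbT.
    by rewrite ler_peMr// ltW.
  have B : (1 - q `^ ((1 - alpha) * p))^-1 <= ((1 - alpha) * (1 - q))^-1.
    apply: powR_bernoulliV; rewrite ?subr_gt0// le_min; apply/andP; split; last lra.
    by rewrite ler_peMr// subr_ge0 ltW.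
  have E : eps `^ p * eps `^ ((alpha - 1) * p) = eps `^ (alpha * p).
    rewrite -powRD; last by apply/implyP => _; rewrite gt_eqF.
    by congr powR; ring.
  apply: (@le_trans _ _ (eps `^ (alpha * p) * ((1 - alpha) * (1 - q))^-1 +
                        eps `^ (alpha * p) * (alpha * (1 - q))^-1)).
    apply: lerD; last by apply: le_trans below _; rewrite ler_wpM2l ?powR_ge0.
    apply: le_trans (ler_wpM2l ep0 above) _.
    by rewrite mulrA E ler_wpM2l ?powR_ge0.
  have -> : eps `^ (alpha * p) * ((1 - alpha) * (1 - q))^-1 +
      eps `^ (alpha * p) * (alpha * (1 - q))^-1 =
      eps `^ (alpha * p) / (alpha - alpha ^+ 2) / (1 - q).
    by field; rewrite !gt_eqF// ?subr_gt0 ?expr2 ?gtr_pMl ?a0.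
  rewrite ler_pM2r ?invr_gt0// ler_peMl// ?ler1n//.
  by rewrite divr_ge0 ?powR_ge0.
- have s0 : 0 < (alpha - 1) * p by rewrite mulr_gt0// subr_gt0.
  have D : (eps / Num.min ((alpha - 1) `^ p^-1) 1) `^ p =
           eps `^ p / Num.min (alpha - 1) 1.
    have a1' : 0 <= alpha - 1 by rewrite subr_ge0 ltW.
    rewrite -powR_div_root ?(ltW e0) ?le_min ?a1' ?ler01//.
    congr ((_ / _) `^ _).
    (* The p-th root is increasing and fixes 1, so it commutes with the minimum against 1. *)
    have root_le u v : 0 <= u -> u <= v -> u `^ p^-1 <= v `^ p^-1.
      move=> u0 uv; apply: ge0_ler_powR; rewrite ?nnegrE ?invr_ge0 ?(ltW p0)//.
      exact: le_trans uv.
    case: (leP (alpha - 1) 1) => a2.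
      by rewrite min_l//; have := root_le _ _ a1' a2; rewrite powR1.
    by rewrite powR1 min_r//; have := root_le _ _ ler01 (ltW a2); rewrite powR1.
  rewrite D; set mu := Num.min _ _.
  have mu0 : 0 < mu by rewrite lt_min subr_gt0 a1 ltr01.
  have mu1 : mu <= 1 by rewrite ge_min lexx orbT.
  have A : (1 - q `^ (alpha * p))^-1 <= (mu * (1 - q))^-1.
    apply: powR_bernoulliV => //; rewrite le_min mu1 andbT.
    by apply: le_trans mu1 _; nra.
  have B : (1 - q `^ ((alpha - 1) * p))^-1 <= (mu * (1 - q))^-1.
    apply: powR_bernoulliV => //; rewrite le_min mu1 andbT.
    apply: (@le_trans _ _ (alpha - 1)); first by rewrite ge_min lexx.
    by rewrite ler_peMr// subr_ge0 ltW.
  apply: (@le_trans _ _ (eps `^ p * (mu * (1 - q))^-1 +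
                         eps `^ p * (mu * (1 - q))^-1)); last first.
    rewrite le_eqVlt; apply/orP; left; apply/eqP; field.
    by rewrite !gt_eqF.
  apply: lerD.
    apply: ler_wpM2l => //; apply: le_trans B.
    rewrite -[leRHS]mul1r; apply: le_trans (geometric_sum_le q _ n q01 s0).
    by apply: ler_sum => k _; case: ifP; rewrite ?powR_ge0.
  apply: le_trans below _; apply: ler_pM => //; rewrite ?powR_ge0//.
    by rewrite invr_ge0 subr_ge0 ltW// powR_lt1.
  apply: ger_powR; first by rewrite e0.
  by nra.
- rewrite a1 in below *; rewrite subrr mul0r mul1r.
  (* At [alpha = 1] all terms above [eps] equal 1, so the sum counts them and yields the
     logarithm. *)
  under eq_bigr do rewrite powRr0.
  have above := count_above q eps n q01 e01.
  have l0 : 0 <= ln eps^-1 by rewrite ln_ge0// invf_ge1.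
  have A : (1 - q `^ p)^-1 <= (1 * (1 - q))^-1.
    by apply: powR_bernoulliV => //; rewrite le_min p1 lexx.
  rewrite powRM ?powR_ge0 ?(ltW e0)// -powRrM mulVf ?gt_eqF// powRr1; last first.
    by rewrite addr_ge0.
  rewrite !mul1r in below A.
  apply: (@le_trans _ _ (eps `^ p * (1 + ln eps^-1 / (1 - q)) + eps `^ p / (1 - q))).
    apply: lerD; first exact: ler_wpM2l.
    by apply: le_trans below _; exact: ler_wpM2l.
  have -> : eps `^ p * (1 + ln eps^-1 / (1 - q)) + eps `^ p / (1 - q) =
     (eps `^ p * ((1 - q) + ln eps^-1 + 1)) / (1 - q) by field; rewrite gt_eqF.
  rewrite ler_pM2r ?invr_gt0// mulrCA ler_wpM2l//; lra.
Qed.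

Lemma Delta_ge0 alpha p eps : 0 < alpha -> 0 <= eps <= 1 ->
  0 <= Delta alpha p eps.
Proof.
move=> a0 /andP[e0 e1]; rewrite /Delta; case: eqP => // /eqP e0'.
case: ifP => _; first by rewrite divr_ge0 ?powR_ge0.
case: ifP => _; first by rewrite mulr_ge0 ?powR_ge0.
by rewrite divr_ge0// le_min powR_ge0 ler01.
Qed.

(** Brings the constants under the p-th power, ready for the final p-th root: [2] and [1 / (1 - q)]
    are at least 1, hence bounded by their p-th powers. *)
Lemma scale_sum_le alpha p q eps n :
    0 < alpha -> 1 <= p -> 0 < q < 1 -> 0 <= eps <= 1 ->
  \sum_(k < n) ((q ^+ k) `^ alpha * Num.min 1 (eps / q ^+ k)) `^ p
    <= (2 * Delta alpha p eps / (1 - q)) `^ p.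
Proof.
move=> a0 p1 q01 e01; have [e0 e1] := andP e01; have [q0 q1] := andP q01.
have p0 : 0 < p by exact: lt_le_trans p1.
(* At [eps = 0] every minimum is 0 and the whole sum vanishes. *)
have [e00|e00] := eqVneq eps 0.
  rewrite big1 ?powR_ge0// => k _.
  by rewrite e00 mul0r min_r ?ler01// mulr0 powR0// gt_eqF.
have D0 := Delta_ge0 alpha p eps a0 e01.
apply: le_trans (scale_sum_le_Delta_powR alpha p q eps n a0 p1 q01 _) _.
  by rewrite lt0r e00 e0.
have q1' : 0 < 1 - q by rewrite subr_gt0.
rewrite powRM ?mulr_ge0 ?invr_ge0 ?(ltW q1')// powRM//.
apply: ler_pM; rewrite ?mulr_ge0 ?powR_ge0 ?invr_ge0 ?(ltW q1')//.
  rewrite ler_wpM2r ?powR_ge0// -[leLHS]powRr1//.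
  by apply: ler_powR => //; rewrite ler1n.
rewrite -[leLHS]powRr1 ?invr_ge0 ?(ltW q1')//.
by apply: ler_powR => //; rewrite invf_ge1//; lra.
Qed.

End GeometricSums.

(** * Gaussian kernels *)

Section GaussianKernel.
Context {R : realType}.
Implicit Types (tau d u v : R) (a b x y : R2 R).

Lemma expRN_sub_le u v : 0 <= u <= v -> expR (- u) - expR (- v) <= (v - u) * expR (- u).
Proof.
move=> /andP[u0 uv].
have -> : expR (- v) = expR (- u) * expR (- (v - u)) by rewrite -expRD; congr expR; ring.
rewrite -[X in X - _]mulr1 -mulrBr mulrC ler_wpM2r ?expR_ge0//.
by have := @expR_ge1Dx R (- (v - u)); lra.
Qed.

(** From [exp (- 1/2) >= 1/2] one gets [exp (1/2) <= 2], and then squares. *)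
Lemma expR1_le4 : expR 1 <= 4 :> R.
Proof.
have h : expR (2^-1) <= 2 :> R.
  rewrite -[leLHS]invrK -expRN -[leRHS]invrK lef_pV2 ?posrE ?expR_gt0 ?invr_gt0//.
  by have := @expR_ge1Dx R (- 2^-1); lra.
have -> : 1 = 2^-1 + 2^-1 :> R by lra.
rewrite expRD; have := expR_gt0 (2^-1 : R); nra.
Qed.

(** The inequality [1 + t <= exp t] bounds the difference by [|u^2 - v^2|] times the exponential at
    the smaller of [u], [v]. Since [d <= 1], the first factor is at most [d (2 u + 1)], and the
    square of the smaller number is at least [u^2 / 2 - 1]. *)
Lemma gauss_profile_lipschitz u v d : 0 <= u -> 0 <= v -> `|u - v| <= d -> d <= 1 ->
  `|expR (- u ^+ 2) - expR (- v ^+ 2)| <= 16 * d * expR (- (u ^+ 2 / 4)).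
Proof.
move=> u0 v0 uvd d1.
have d0 : 0 <= d by exact: le_trans uvd.
have key : `|expR (- u ^+ 2) - expR (- v ^+ 2)|
    <= d * (2 * u + 1) * expR (1 - u ^+ 2 / 2).
  move: uvd; rewrite ler_norml => /andP[uvd1 uvd2].
  have [uv|vu] := leP u v.
    rewrite ger0_norm; last first.
      by rewrite subr_ge0 ler_expR lerN2 ler_sqr.
    apply: le_trans (expRN_sub_le _ _ _) _.
      by rewrite sqr_ge0 ler_sqr.
    apply: ler_pM; rewrite ?expR_ge0 ?subr_ge0 ?ler_sqr//; first by nra.
    by rewrite ler_expR; nra.
  rewrite ler0_norm; last first.
    by rewrite subr_le0 ler_expR lerN2 ler_sqr// ltW.
  rewrite opprB; apply: le_trans (expRN_sub_le _ _ _) _.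
    by rewrite sqr_ge0 ler_sqr// ltW.
  apply: ler_pM; rewrite ?expR_ge0 ?subr_ge0 ?ler_sqr//; first exact: ltW; first by nra.
  rewrite ler_expR; have := sqr_ge0 (u - 2 * v); nra.
apply: le_trans key _.
(* One copy of [exp (- u^2 / 4)] is kept and the other absorbs [2 u + 1] at the cost of a factor 4;
   with [e <= 4] this gives the constant 16. *)
have -> : 1 - u ^+ 2 / 2 = 1 + (- (u ^+ 2 / 4) + - (u ^+ 2 / 4)) by field.
have q1 : (2 * u + 1) * expR (- (u ^+ 2 / 4)) <= 4.
  rewrite expRN ler_pdivrMr ?expR_gt0//.
  have := @expR_ge1Dx R (u ^+ 2 / 4); have := sqr_ge0 (u - 1); nra.
rewrite !expRD; set E := expR (- (u ^+ 2 / 4)) in q1 *.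
have E0 : 0 <= E by exact: expR_ge0.
have e4 := expR1_le4; have e0 : 0 <= expR 1 :> R by exact: expR_ge0.
rewrite (_ : d * (2 * u + 1) * _ = d * E * (expR 1 * ((2 * u + 1) * E))); last by ring.
rewrite (_ : 16 * d * E = d * E * (4 * 4)); last by ring.
apply: ler_wpM2l; first exact: mulr_ge0.
by apply: ler_pM => //; rewrite mulr_ge0// addr_ge0// mulr_ge0.
Qed.

Lemma enorm2_ge0 x : 0 <= enorm2 x. Proof. exact: sqrtr_ge0. Qed.

Lemma sqr_enorm2 x : enorm2 x ^+ 2 = x.1 ^+ 2 + x.2 ^+ 2.
Proof. by rewrite sqr_sqrtr// addr_ge0// sqr_ge0. Qed.

Lemma enorm2D x y : enorm2 (x.1 + y.1, x.2 + y.2) <= enorm2 x + enorm2 y.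
Proof.
rewrite -ler_sqr ?nnegrE ?addr_ge0 ?enorm2_ge0//.
rewrite sqrrD !sqr_enorm2/=.
suff : x.1 * y.1 + x.2 * y.2 <= enorm2 x * enorm2 y by nra.
have [h|h] := leP 0 (x.1 * y.1 + x.2 * y.2); last first.
  by apply: le_trans (ltW h) _; rewrite mulr_ge0 ?enorm2_ge0.
rewrite -ler_sqr ?nnegrE ?mulr_ge0 ?enorm2_ge0// exprMn !sqr_enorm2.
by have := sqr_ge0 (x.1 * y.2 - x.2 * y.1); nra.
Qed.

Lemma enorm2_lipschitz a b : `|enorm2 a - enorm2 b| <= enorm2 (a.1 - b.1, a.2 - b.2).
Proof.
have N (z w : R) : enorm2 (z, w) = enorm2 (- z, - w) by rewrite /enorm2/= !sqrrN.
have T (z w : R2 R) : enorm2 z <= enorm2 (z.1 - w.1, z.2 - w.2) + enorm2 w.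
  by have := enorm2D (z.1 - w.1, z.2 - w.2) w; rewrite /= !subrK -surjective_pairing.
rewrite ler_norml; apply/andP; split; last by rewrite lerBlDr T.
by have := T b a; rewrite N !opprB; lra.
Qed.

Lemma gauss2_ge0 tau x : 0 < tau -> 0 <= gauss2 tau x.
Proof. by move=> t0; rewrite mulr_ge0 ?expR_ge0// invr_ge0 mulr_ge0 ?pi_ge0// ltW. Qed.

Lemma gauss2_le tau x : 0 < tau -> gauss2 tau x <= (pi * tau)^-1.
Proof.
move=> t0; rewrite /gauss2 ler_piMr ?invr_ge0 ?mulr_ge0 ?pi_ge0 ?(ltW t0)//.
by rewrite -expR0 ler_expR oppr_le0 divr_ge0 ?sqr_ge0 ?(ltW t0).
Qed.

Lemma gauss2N tau (z w : R) : gauss2 tau (- z, - w) = gauss2 tau (z, w).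
Proof. by rewrite /gauss2 /enorm2/= !sqrrN. Qed.

(** The radial profile estimate at the lengths divided by [sqrt tau]. The exponent [u^2 / 4] is that
    of the kernel at scale [4 tau], whose prefactor is smaller by 4, which turns 16 into 64. *)
Lemma gauss2_lipschitz tau d a b : 0 < tau -> d ^+ 2 <= tau ->
    enorm2 (a.1 - b.1, a.2 - b.2) <= d ->
  `|gauss2 tau a - gauss2 tau b| <= 64 * (d / Num.sqrt tau) * gauss2 (4 * tau) a.
Proof.
move=> t0 dt abd.
have d0 : 0 <= d by apply: le_trans abd; exact: enorm2_ge0.
have s0 : 0 < Num.sqrt tau by rewrite sqrtr_gt0.
have st : Num.sqrt tau ^+ 2 = tau by rewrite sqr_sqrtr ?ltW.
rewrite /gauss2 -mulrBr normrM ger0_norm ?invr_ge0 ?mulr_ge0 ?pi_ge0 ?(ltW t0)//.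
have E z : enorm2 z ^+ 2 / tau = (enorm2 z / Num.sqrt tau) ^+ 2.
  by rewrite expr_div_n st.
have -> : enorm2 a ^+ 2 / (4 * tau) = (enorm2 a / Num.sqrt tau) ^+ 2 / 4.
  by rewrite -E; field; rewrite gt_eqF.
rewrite !E.
have p0 : 0 < pi :> R by exact: pi_gt0.
have -> : (pi * (4 * tau))^-1 = (pi * tau)^-1 / 4 by rewrite mulrCA invfM mulrC.
have H := @gauss_profile_lipschitz (enorm2 a / Num.sqrt tau)
  (enorm2 b / Num.sqrt tau) (d / Num.sqrt tau).
set k := (pi * tau)^-1; set e := expR (- (_ / 4)).
rewrite (_ : 64 * _ * _ = k * (16 * (d / Num.sqrt tau) * e)); last by field; rewrite gt_eqF.
apply: ler_wpM2l; first by rewrite invr_ge0 mulr_ge0 ?ltW.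
apply: H; rewrite ?divr_ge0 ?enorm2_ge0 ?(ltW s0)//.
- rewrite -mulrBl normrM [X in _ * X]ger0_norm ?invr_ge0 ?(ltW s0)//.
  by rewrite ler_pM2r ?invr_gt0// (le_trans (enorm2_lipschitz a b)).
- rewrite ler_pdivrMr// mul1r.
  by rewrite -ler_sqr ?nnegrE ?(ltW s0)// st.
Qed.

Lemma measurable_gauss2 tau : measurable_fun setT (gauss2 tau).
Proof.
have -> : gauss2 tau = fun x => (pi * tau)^-1 * expR (- ((x.1 ^+ 2 + x.2 ^+ 2) / tau)).
  by apply/funext => x; rewrite /gauss2 sqr_enorm2.
apply: measurable_funM => //; apply: measurableT_comp => //.
apply: measurableT_comp => //; apply: measurable_funM => //.
by apply: measurable_funD; apply: measurable_funX;
  [exact: measurable_fst|exact: measurable_snd].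
Qed.

(** The kernel is the product of two centred normal densities of variance [tau / 2]. *)
Lemma integral_gauss2 tau : 0 < tau -> (\int[leb2 R]_x (gauss2 tau x)%:E = 1)%E.
Proof.
move=> t0.
set s := Num.sqrt (tau / 2).
have s0 : s != 0 by rewrite gt_eqF// sqrtr_gt0 divr_gt0.
have s2 : s ^+ 2 = tau / 2 by rewrite sqr_sqrtr// divr_ge0// ltW.
have p0 : 0 < pi :> R by exact: pi_gt0.
rewrite /leb2 fubini_tonelli1/=; last 2 first.
- by apply/measurable_EFinP; exact: measurable_gauss2.
- by move=> x; rewrite lee_fin gauss2_ge0.
have E (x y : R) : (gauss2 tau (x, y))%:E =
    ((normal_pdf 0 s x)%:E * (normal_pdf 0 s y)%:E)%E.
  rewrite -EFinM !normal_pdfE// /gauss2 sqr_enorm2/= /normal_peak /normal_fun.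
  rewrite s2 mulrACA -expRD -invfM -expr2 sqr_sqrtr; last first.
    by rewrite mulrn_wge0// mulr_ge0 ?divr_ge0 ?ltW.
  congr (_%:E); congr (_^-1 * expR _).
    by rewrite -mulr_natr; field.
  by rewrite !subr0 -mulr_natr; field; rewrite gt_eqF.
rewrite /fubini_F.
under eq_integral do under eq_integral do rewrite E.
under eq_integral => x _.
  rewrite ge0_integralZl//; last 3 first.
  - by apply/measurable_EFinP; exact: measurable_normal_pdf.
  - by move=> y _; rewrite lee_fin normal_pdf_ge0.
  - by rewrite lee_fin normal_pdf_ge0.
  rewrite integral_normal_pdf mule1.
  over.
exact: integral_normal_pdf.
Qed.

End GaussianKernel.

(** * Invariance of Lebesgue measure *)

Section LebesgueInvariance.
Context {R : realType}.
Implicit Types a b c : R.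
Local Open Scope ereal_scope.

Lemma lebesgue_measureDr a (A : set R) : measurable A ->
  pushforward (@lebesgue_measure R) ((+%R^~ a) : _ -> measurableTypeR R) A
    = lebesgue_measure A.
Proof.
move=> mA.
apply/esym/lebesgue_measure_unique => //=; first exact: measurable_funD.
move=> _ _ [[u v]] _ <-.
rewrite /pushforward [X in _ = lebesgue_measure X](_ : _ = `]u - a, v - a]%classic)%R.
  rewrite !lebesgue_measure_itv/= !lte_fin ltrD2r; case: ifP => // _.
  by rewrite -!EFinB; congr (_%:E); ring.
by apply/seteqP; split => x /=; rewrite !in_itv/= ltrBlDr lerBrDr.
Qed.

Lemma ge0_integral_leb1Dr a (F : R -> \bar R) :
  measurable_fun setT F -> (forall x, 0 <= F x) ->
  \int[leb1 R]_x F (x + a)%R = \int[leb1 R]_x F x.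
Proof.
move=> mF F0.
transitivity (\int[pushforward (@lebesgue_measure R)
    ((+%R^~ a) : measurableTypeR R -> measurableTypeR R)]_x F x).
  by rewrite ge0_integral_pushforward//=; exact: measurable_funD.
apply: eq_measure_integral; first exact: measurable_funD.
by move=> ? A mA _; exact: lebesgue_measureDr.
Qed.

Lemma leb2_sigma_finite : sigma_finite setT (leb2 R).
Proof.
have /sigma_finiteP[F [TF ndF Foo]] := sigma_finiteT (@lebesgue_measure R).
exists (fun n => F n `*` F n).
  rewrite -setXTT TF predeqE => -[x y]; split.
    move=> [/= [n _ Fnx] [k _ Gky]]; exists (maxn n k) => //; split.
    - by move: x Fnx; exact/subsetPset/ndF/leq_maxl.
    - by move: y Gky; exact/subsetPset/ndF/leq_maxr.
  by move=> [n _ []/= ? ?]; split; exists n.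
move=> k; have [mFk Fkoo] := Foo k; split; first exact: measurableX.
have -> : leb2 R (F k `*` F k) = (lebesgue_measure (F k) * lebesgue_measure (F k))%E.
  exact: product_measure1E.
by rewrite lte_mul_pinfty// ge0_fin_numE.
Qed.

(* The canonical structures on a product measure only record sigma-finiteness when
   both factors are finite measures. *)
Definition leb2_sf : {sigma_finite_measure set (R2 R) -> \bar R} :=
  HB.pack_for {sigma_finite_measure set (R2 R) -> \bar R} (Measure.sort (leb2 R))
   (Measure_isSigmaFinite.Build _ _ _ (leb2 R) leb2_sigma_finite).

Lemma leb2_fubini1 (F : R2 R -> \bar R) :
  measurable_fun setT F -> (forall x, 0 <= F x) ->
  \int[leb2 R]_x F x = \int[leb1 R]_x \int[leb1 R]_y F (x, y).
Proof.
move=> mF F0.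
exact: (@fubini_tonelli1 _ _ _ _ R (@lebesgue_measure R) (@lebesgue_measure R) F mF F0).
Qed.

Lemma leb2_fubini2 (F : R2 R -> \bar R) :
  measurable_fun setT F -> (forall x, 0 <= F x) ->
  \int[leb2 R]_x F x = \int[leb1 R]_y \int[leb1 R]_x F (x, y).
Proof.
move=> mF F0.
exact: (@fubini_tonelli2 _ _ _ _ R (@lebesgue_measure R) (@lebesgue_measure R) F mF F0).
Qed.

Lemma leb3_fubini1 (F : R3 R -> \bar R) :
  measurable_fun setT F -> (forall x, 0 <= F x) ->
  \int[leb3 R]_x F x = \int[leb2 R]_x \int[leb1 R]_y F (x, y).
Proof.
move=> mF F0.
exact: (@fubini_tonelli1 _ _ _ _ R leb2_sf (@lebesgue_measure R) F mF F0).
Qed.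

Lemma leb3_fubini2 (F : R3 R -> \bar R) :
  measurable_fun setT F -> (forall x, 0 <= F x) ->
  \int[leb3 R]_x F x = \int[leb1 R]_y \int[leb2 R]_x F (x, y).
Proof.
move=> mF F0.
exact: (@fubini_tonelli2 _ _ _ _ R leb2_sf (@lebesgue_measure R) F mF F0).
Qed.

Lemma ge0_integral_leb2D (a : R2 R) (F : R2 R -> \bar R) :
  measurable_fun setT F -> (forall x, 0 <= F x) ->
  \int[leb2 R]_x F (x.1 + a.1, x.2 + a.2)%R = \int[leb2 R]_x F x.
Proof.
move=> mF F0.
have mD : measurable_fun setT (fun x : R2 R => (x.1 + a.1, x.2 + a.2)%R : R2 R).
  by apply/measurable_fun_pairP; split; exact: measurable_funD.
rewrite leb2_fubini1//; last exact: measurableT_comp.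
under eq_integral => x _.
  rewrite (ge0_integral_leb1Dr a.2 (fun y => F (x + a.1, y)%R))//; last first.
    by apply: measurableT_comp => //; exact: pair1_measurable.
  over.
have mD1 : measurable_fun setT (fun x : R2 R => (x.1 + a.1, x.2)%R : R2 R).
  by apply/measurable_fun_pairP; split; [exact: measurable_funD|exact: measurable_snd].
rewrite -(leb2_fubini1 (fun x => F (x.1 + a.1, x.2)%R))//; last first.
  exact: (measurableT_comp mF mD1).
rewrite leb2_fubini2//; last exact: (measurableT_comp mF mD1).
rewrite (leb2_fubini2 F mF F0).
apply: eq_integral => y _.
rewrite (ge0_integral_leb1Dr a.1 (fun x => F (x, y)%R))//.
by apply: measurableT_comp => //; exact: pair2_measurable.
Qed.

Definition shear_xy a b (x : R3 R) : R3 R :=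
  (x.1.1 + a * x.2, x.1.2 + b * x.2, x.2)%R.

Definition shear_z a b (x : R3 R) : R3 R :=
  (x.1, x.2 + (a * x.1.1 + b * x.1.2))%R.

Lemma measurable_coord11 : measurable_fun setT (fun x : R3 R => x.1.1).
Proof. by apply: measurableT_comp; exact: measurable_fst. Qed.

Lemma measurable_coord12 : measurable_fun setT (fun x : R3 R => x.1.2).
Proof. by apply: measurableT_comp; [exact: measurable_snd|exact: measurable_fst]. Qed.

Lemma measurable_coord2 : measurable_fun setT (fun x : R3 R => x.2).
Proof. exact: measurable_snd. Qed.

Lemma measurable_shear_xy a b : measurable_fun setT (shear_xy a b).
Proof.
have m11 := measurable_coord11; have m12 := measurable_coord12.
have m2 := measurable_coord2.
apply/measurable_fun_pairP; split; last exact: m2.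
by apply/measurable_fun_pairP; split; apply: measurable_funD => //;
  apply: measurable_funM.
Qed.

Lemma measurable_shear_z a b : measurable_fun setT (shear_z a b).
Proof.
have m11 := measurable_coord11; have m12 := measurable_coord12.
apply/measurable_fun_pairP; split; first exact: measurable_fst.
apply: measurable_funD; first exact: measurable_coord2.
by apply: measurable_funD; exact: measurable_funM.
Qed.

(** On each horizontal slice the shear is a translation, so Fubini reduces the claim to translation
    invariance in the plane. The vertical shear below is treated likewise on vertical lines. *)
Lemma ge0_integral_shear_xy a b (F : R3 R -> \bar R) :
  measurable_fun setT F -> (forall x, 0 <= F x) ->
  \int[leb3 R]_x F (shear_xy a b x) = \int[leb3 R]_x F x.
Proof.
move=> mF F0.
rewrite (leb3_fubini2 (F \o shear_xy a b)); last 2 first.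
- exact: (measurableT_comp mF (measurable_shear_xy a b)).
- by move=> x; exact: F0.
rewrite (leb3_fubini2 F mF F0); apply: eq_integral => z _.
rewrite -(ge0_integral_leb2D (a * z, b * z)%R (fun x => F (x, z)))//.
by apply: (measurableT_comp mF); exact: pair2_measurable.
Qed.

Lemma ge0_integral_shear_z a b (F : R3 R -> \bar R) :
  measurable_fun setT F -> (forall x, 0 <= F x) ->
  \int[leb3 R]_x F (shear_z a b x) = \int[leb3 R]_x F x.
Proof.
move=> mF F0.
rewrite (leb3_fubini1 (F \o shear_z a b)); last 2 first.
- exact: (measurableT_comp mF (measurable_shear_z a b)).
- by move=> x; exact: F0.
rewrite (leb3_fubini1 F mF F0); apply: eq_integral => x _.
rewrite -(ge0_integral_leb1Dr (a * x.1 + b * x.2)%R (fun z => F (x, z)))//.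
by apply: (measurableT_comp mF); exact: pair1_measurable.
Qed.

(* The minimal rotation taking e_z to the unit vector [(a, b, c)]. *)
Definition tilt a b c (x : R3 R) : R3 R :=
  (x.1.1 - a * ((a * x.1.1 + b * x.1.2) / (1 + c)) + a * x.2,
   x.1.2 - b * ((a * x.1.1 + b * x.1.2) / (1 + c)) + b * x.2,
   c * x.2 - (a * x.1.1 + b * x.1.2))%R.

(** The factorization of a plane rotation by [theta] into shears of slopes [tan(theta/2)],
    [- sin theta], [tan(theta/2)], in the plane of [e_z] and [(a, b, c)]: there [c = cos theta], the
    vector [(a, b)] has length [sin theta], and [sin theta / (1 + c) = tan(theta/2)]. *)
Lemma tilt_shears a b c (x : R3 R) :
  (a ^+ 2 + b ^+ 2 + c ^+ 2 = 1)%R -> (1 + c != 0)%R ->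
  tilt a b c x = shear_xy (a / (1 + c)) (b / (1 + c))
    (shear_z (- a) (- b) (shear_xy (a / (1 + c)) (b / (1 + c)) x)).
Proof.
move=> abc c1; rewrite /tilt /shear_xy /shear_z/=.
case: x => [[x y] z]/=; set k := (1 + c)^-1%R.
have kc : (k * c = 1 - k)%R by rewrite -(mulVf c1) -/k; ring.
have s2 : (b ^+ 2 = 1 - c ^+ 2 - a ^+ 2)%R by rewrite -abc; ring.
have ks : (k * (a ^+ 2 + b ^+ 2) = 1 - c)%R.
  have -> : (a ^+ 2 + b ^+ 2 = (1 + c) * (1 - c))%R by rewrite s2; ring.
  by rewrite mulrA mulVf// mul1r.
have E : (z + (- a * (x + a * k * z) + - b * (y + b * k * z))
  = c * z - (a * x + b * y))%R.
  transitivity (z - (a * x + b * y) - k * (a ^+ 2 + b ^+ 2) * z)%R; first ring.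
  by rewrite ks; ring.
by rewrite E; congr (_, _, _); ring: kc.
Qed.

Lemma ge0_integral_tilt a b c (F : R3 R -> \bar R) :
  (a ^+ 2 + b ^+ 2 + c ^+ 2 = 1)%R -> (1 + c != 0)%R ->
  measurable_fun setT F -> (forall x, 0 <= F x) ->
  \int[leb3 R]_x F (tilt a b c x) = \int[leb3 R]_x F x.
Proof.
move=> abc c1 mF F0.
set s := shear_xy (a / (1 + c)) (b / (1 + c)); set t := shear_z (- a) (- b).
have ms : measurable_fun setT s by exact: measurable_shear_xy.
have mt : measurable_fun setT t by exact: measurable_shear_z.
under eq_integral do rewrite (tilt_shears _ _ _ _ abc c1) -/s -/t.
rewrite (ge0_integral_shear_xy _ _ (fun x => F (s (t x)))) //; last first.
  by apply: (measurableT_comp mF); exact: (measurableT_comp ms mt).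
rewrite (ge0_integral_shear_z _ _ (fun x => F (s x))) //; last first.
  exact: (measurableT_comp mF ms).
by rewrite ge0_integral_shear_xy.
Qed.

(** Reversing the horizontal part of the axis direction reverses the rotation, so
    [tilt (- a) (- b) c] serves as the inverse [V^T]. *)
Lemma tiltK a b c (x : R3 R) :
  (a ^+ 2 + b ^+ 2 + c ^+ 2 = 1)%R -> (1 + c != 0)%R ->
  tilt a b c (tilt (- a) (- b) c x) = x.
Proof.
move=> abc c1; rewrite /tilt/=.
case: x => [[x y] z]/=; set k := (1 + c)^-1%R.
(* [kc] encodes [k = 1 / (1 + c)] polynomially and [s2] the unit sphere; the identity is then
   checked by [ring] modulo these two relations. *)
have kc : (k * c = 1 - k)%R by rewrite -(mulVf c1) -/k; ring.
have s2 : (b ^+ 2 = 1 - c ^+ 2 - a ^+ 2)%R by rewrite -abc; ring.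
by congr (_, _, _); ring: kc s2.
Qed.

Lemma measurable_tilt a b c : measurable_fun setT (tilt a b c).
Proof.
have m11 := measurable_coord11; have m12 := measurable_coord12.
have m2 := measurable_coord2.
have ml : measurable_fun setT (fun x : R3 R => a * x.1.1 + b * x.1.2)%R.
  by apply: measurable_funD; exact: measurable_funM.
apply/measurable_fun_pairP; split; last first.
  by apply: measurable_funB => //; exact: measurable_funM.
apply/measurable_fun_pairP; split.
  apply: measurable_funD; last exact: measurable_funM.
  apply: measurable_funB => //; apply: measurable_funM => //.
  exact: measurable_funM.
apply: measurable_funD; last exact: measurable_funM.
apply: measurable_funB => //; apply: measurable_funM => //.
exact: measurable_funM.
Qed.

End LebesgueInvariance.

(** * Young's inequality *)

Lemma lee_poweR (R : realType) (r : R) (x y : \bar R) :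
  0 <= r -> (0 <= x -> x <= y -> x `^ r <= y `^ r)%E.
Proof.
move=> r0 x0 xy; apply: gt0_ler_poweR => //; rewrite in_itv/= leey andbT//.
exact: le_trans xy.
Qed.

(** Jensen's inequality for the density [k], obtained from Hölder's by splitting [k] as
    [k^(1/q) k^(1/r)]: the first factor has L^q norm 1. The exponent [r = 1], whose conjugate is
    infinite, is treated first. *)
Lemma jensen_powR d (T : measurableType d) (R : realType)
    (mu : {measure set T -> \bar R}) (k g : T -> R) (r : R) :
  measurable_fun setT k -> measurable_fun setT g ->
  (forall x, 0 <= k x) -> (forall x, 0 <= g x) ->
  (\int[mu]_x (k x)%:E = 1)%E -> 1 <= r ->
  ((\int[mu]_x (k x * g x)%:E) `^ r <= \int[mu]_x (k x * g x `^ r)%:E)%E.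
Proof.
move=> mk mg k0 g0 k1; rewrite le_eqVlt => /predU1P[<-|r1].
  rewrite poweRe1; last by apply: integral_ge0 => x _; rewrite lee_fin mulr_ge0.
  by under [leRHS]eq_integral do rewrite powRr1//.
have r0 : 0 < r by lra.
pose q := r / (r - 1).
have q0 : 0 < q by rewrite divr_gt0// subr_gt0.
have qr : q^-1 + r^-1 = 1.
  by rewrite /q; field; rewrite subr_eq0 !gt_eqF.
have mpow (u : T -> R) (s : R) : measurable_fun setT u ->
    measurable_fun setT (fun x => u x `^ s).
  exact: (@measurableT_comp _ _ _ _ _ _ (@powR R ^~ s)).
have H := @hoelder _ T R mu (fun x => k x `^ q^-1) (fun x => k x `^ r^-1 * g x)
   q r (mpow _ _ mk) (measurable_funM (mpow _ _ mk) mg) q0 r0 qr.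
have E1 : (\int[mu]_x (k x * g x)%:E = 'N[mu]_1[EFin \o
    ((fun x => k x `^ q^-1) \* (fun x => k x `^ r^-1 * g x))%R])%E.
  rewrite Lnorm1; apply: eq_integral => x _ /=.
  rewrite ger0_norm ?mulr_ge0 ?powR_ge0// mulrA -powRD ?qr ?powRr1//.
  by rewrite oner_eq0.
have E2 : ('N[mu]_q%:E[EFin \o (fun x => k x `^ q^-1)%R] = 1)%E.
  rewrite unlock /=; under eq_integral => x _.
    rewrite /= ger0_norm ?powR_ge0// -powRrM mulVf ?gt_eqF// powRr1//.
    over.
  by rewrite k1 poweR1r.
have E3 : ('N[mu]_r%:E[EFin \o (fun x => k x `^ r^-1 * g x)%R] `^ r =
    \int[mu]_x (k x * g x `^ r)%:E)%E.
  rewrite poweR_Lnorm ?gt_eqF//; apply: eq_integral => x _ /=.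
  rewrite ger0_norm ?mulr_ge0 ?powR_ge0// powRM ?powR_ge0//.
  by rewrite -powRrM mulVf ?gt_eqF// powRr1.
rewrite E1 -E3; apply: lee_poweR; rewrite ?(ltW r0) ?Lnorm_ge0//.
by apply: le_trans H _; rewrite E2 mul1e.
Qed.

Section Young.
Context {R : realType}.
Local Open Scope ereal_scope.

Lemma measurable_sub2 : measurable_fun setT
  (fun z : R2 R * R2 R => (z.1.1 - z.2.1, z.1.2 - z.2.2)%R : R2 R).
Proof.
have m1 := @measurable_fst _ _ (R2 R) (R2 R).
have m2 := @measurable_snd _ _ (R2 R) (R2 R).
by apply/measurable_fun_pairP; split; apply: measurable_funB;
  apply: measurableT_comp => //; (exact: measurable_fst || exact: measurable_snd).
Qed.

Lemma measurable_convolution_integrand (K : R2 R -> R) (g : R2 R -> \bar R) :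
  measurable_fun setT K -> measurable_fun setT g ->
  measurable_fun setT (fun z : R2 R * R2 R =>
    (K (z.1.1 - z.2.1, z.1.2 - z.2.2)%R)%:E * g z.2).
Proof.
move=> mK mg; apply: emeasurable_funM.
  apply/measurable_EFinP; exact: (measurableT_comp mK measurable_sub2).
by apply: measurableT_comp => //; exact: measurable_snd.
Qed.

Lemma measurable_ge0_convolution (K : R2 R -> R) (g : R2 R -> \bar R) :
  measurable_fun setT K -> (forall x, (0 <= K x)%R) ->
  measurable_fun setT g -> (forall x, 0 <= g x) ->
  measurable_fun setT (fun x : R2 R =>
    \int[leb2 R]_y ((K (x.1 - y.1, x.2 - y.2)%R)%:E * g y)).
Proof.
move=> mK K0 mg g0.
have m := measurable_convolution_integrand K g mK mg.
have f0 (z : R2 R * R2 R) : 0 <= (K (z.1.1 - z.2.1, z.1.2 - z.2.2)%R)%:E * g z.2.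
  by rewrite mule_ge0 ?lee_fin.
exact: (@measurable_fun_fubini_tonelli_F _ _ _ _ R leb2_sf _ m f0).
Qed.

Variable K : R2 R -> R.
Hypotheses (mK : measurable_fun setT K) (K0 : forall x, (0 <= K x)%R).
Hypothesis K1 : \int[leb2 R]_x (K x)%:E = 1.

Lemma integral_translate_left (y : R2 R) :
  \int[leb2 R]_x (K (x.1 - y.1, x.2 - y.2)%R)%:E = 1.
Proof.
by rewrite -K1 -(ge0_integral_leb2D (- y.1, - y.2)%R (EFin \o K))//=;
  exact/measurable_EFinP.
Qed.

Hypothesis KN : forall z w : R, K (- z, - w)%R = K (z, w).

Lemma integral_translate_right (x : R2 R) :
  \int[leb2 R]_y (K (x.1 - y.1, x.2 - y.2)%R)%:E = 1.
Proof.
rewrite -(integral_translate_left x); apply: eq_integral => y _.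
by rewrite -KN !opprB.
Qed.

Lemma measurable_translate (x : R2 R) :
  measurable_fun setT (fun y : R2 R => K (x.1 - y.1, x.2 - y.2)%R).
Proof.
apply: (measurableT_comp mK).
apply/measurable_fun_pairP; split; apply: measurable_funB => //.
Qed.

(** Jensen for the probability density [y -> K (x - y)], then Tonelli: integrating in [x] first
    makes the kernel disappear. *)
Lemma young_fin (g : R2 R -> R) (r : R) : (1 <= r)%R ->
  measurable_fun setT g -> (forall x, (0 <= g x)%R) ->
  \int[leb2 R]_x (\int[leb2 R]_y (K (x.1 - y.1, x.2 - y.2)%R * g y)%:E) `^ r
  <= \int[leb2 R]_x (g x `^ r)%:E.
Proof.
move=> r1 mg g0.
have r0 : (0 < r)%R by lra.
have mgr : measurable_fun setT (fun x => g x `^ r)%R.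
  exact: (@measurableT_comp _ _ _ _ _ _ (@powR R ^~ r)).
have mcv (h : R2 R -> R) : measurable_fun setT h -> (forall x, (0 <= h x)%R) ->
    measurable_fun setT (fun x : R2 R =>
      \int[leb2 R]_y (K (x.1 - y.1, x.2 - y.2)%R * h y)%:E).
  move=> mh h0; apply: (measurable_ge0_convolution K (EFin \o h)) => //.
  exact/measurable_EFinP.
apply: (@le_trans _ _ (\int[leb2 R]_x \int[leb2 R]_y
    (K (x.1 - y.1, x.2 - y.2)%R * g y `^ r)%:E)).
  apply: ge0_le_integral => //.
  - by move=> x _; exact: poweR_ge0.
  - apply: (@measurableT_comp _ _ _ _ _ _ (@poweR R ^~ r)); last exact: mcv.
    exact: measurable_poweR.
  - by apply: mcv => // x; exact: powR_ge0.
  - move=> x _; apply: jensen_powR => //; first exact: measurable_translate.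
    exact: integral_translate_right.
rewrite (@fubini_tonelli _ _ _ _ R leb2_sf leb2_sf (fun z =>
    (K (z.1.1 - z.2.1, z.1.2 - z.2.2)%R * g z.2 `^ r)%:E)).
- rewrite le_eqVlt; apply/orP; left; apply/eqP; apply: eq_integral => y _ /=.
  under eq_integral do rewrite EFinM.
  rewrite ge0_integralZr//.
  + by rewrite integral_translate_left mul1e.
  + apply/measurable_EFinP; apply: (measurableT_comp mK).
    by apply/measurable_fun_pairP; split; apply: measurable_funB.
  + by move=> x _; rewrite lee_fin.
  + by rewrite lee_fin powR_ge0.
- apply: (measurable_convolution_integrand K (fun y => (g y `^ r)%:E)) => //.
  exact/measurable_EFinP.
- by move=> z; rewrite lee_fin mulr_ge0// powR_ge0.
Qed.

(** Extends the inequality to functions with infinite values. If the right side is finite, [g] is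
    finite almost everywhere and may be replaced by [fine \o g] under all the integrals. *)
Lemma young (g : R2 R -> \bar R) (r : R) : (1 <= r)%R ->
  measurable_fun setT g -> (forall x, 0 <= g x) ->
  \int[leb2 R]_x (\int[leb2 R]_y ((K (x.1 - y.1, x.2 - y.2)%R)%:E * g y)) `^ r
  <= \int[leb2 R]_x (g x `^ r).
Proof.
move=> r1 mg g0.
have r0 : (0 < r)%R by lra.
have mgr : measurable_fun setT (fun x => g x `^ r).
  exact: (measurableT_comp (measurable_poweR r) mg).
have [->|foo] := eqVneq (\int[leb2 R]_x (g x `^ r)) +oo; first by rewrite leey.
have ig : (leb2 R).-integrable setT (fun x => g x `^ r).
  apply/integrableP; split => //.
  by under eq_integral do rewrite gee0_abs ?poweR_ge0//; rewrite ltey.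
have gae : {ae leb2 R, forall x, g x = (fine (g x))%:E}.
  have := integrable_ae measurableT ig; apply: filterS => x /(_ I) h.
  rewrite fineK// ge0_fin_numE//.
  case: (g x) h (g0 x) => [t|//|//]; first by rewrite ltry.
  by rewrite poweRyr// gt_eqF.
have mfg : measurable_fun setT (fine \o g).
  by apply: measurableT_comp => //.
have fg0 x : (0 <= fine (g x))%R by rewrite fine_ge0.
have -> : \int[leb2 R]_x (g x `^ r) = \int[leb2 R]_x ((fine (g x) `^ r)%R)%:E.
  apply: ge0_ae_eq_integral => //.
  - apply/measurable_EFinP.
    exact: (@measurableT_comp _ _ _ _ _ _ (@powR R ^~ r)).
  - by move=> x _; exact: poweR_ge0.
  - by move=> x _; rewrite lee_fin powR_ge0.
  - by apply: filterS gae => x -> _.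
have H := @young_fin (fine \o g) r r1 mfg fg0.
apply: le_trans H; rewrite le_eqVlt; apply/orP; left; apply/eqP.
apply: eq_integral => x _; congr (_ `^ _).
apply: ge0_ae_eq_integral => //.
- apply: emeasurable_funM => //; apply/measurable_EFinP.
  exact: measurable_translate.
- by apply/measurable_EFinP/measurable_funM => //; exact: measurable_translate.
- by move=> y _; rewrite mule_ge0 ?lee_fin.
- by move=> y _; rewrite lee_fin mulr_ge0 ?K0 ?(fg0 y).
- by apply: filterS gae => y + _; rewrite EFinM => <-.
Qed.

Lemma Lnorm_le_young (D : R2 R -> R) (g : R2 R -> \bar R) (c r : R) :
  (0 <= c)%R -> (1 <= r)%R ->
  measurable_fun setT D -> measurable_fun setT g -> (forall x, 0 <= g x) ->
  (forall x, `|D x|%:E <= c%:E *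
     \int[leb2 R]_y ((K (x.1 - y.1, x.2 - y.2)%R)%:E * g y)) ->
  'N[leb2 R]_r%:E[EFin \o D] <= c%:E * 'N[leb2 R]_r%:E[g].
Proof.
move=> c0 r1 mD mg g0 Dg.
have r0 : (0 < r)%R by lra.
have cE : c%:E = (c%:E `^ r) `^ r^-1.
  by rewrite -poweRrM mulfV ?gt_eqF// poweRe1.
have I0 : 0 <= \int[leb2 R]_x `|g x| `^ r.
  by apply: integral_ge0 => x _; exact: poweR_ge0.
have C0 x : 0 <= \int[leb2 R]_y ((K (x.1 - y.1, x.2 - y.2)%R)%:E * g y).
  by apply: integral_ge0 => y _; rewrite mule_ge0 ?lee_fin.
have mC : measurable_fun setT (fun x : R2 R =>
    (\int[leb2 R]_y ((K (x.1 - y.1, x.2 - y.2)%R)%:E * g y))).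
  exact: measurable_ge0_convolution.
have mp (h : R2 R -> \bar R) : measurable_fun setT h ->
    measurable_fun setT (fun x => h x `^ r).
  exact: (measurableT_comp (measurable_poweR r)).
rewrite unlock {1}cE -poweRM ?poweR_ge0//.
apply: lee_poweR; first by rewrite invr_ge0 ltW.
  by apply: integral_ge0 => x _; exact: poweR_ge0.
apply: (@le_trans _ _ (c%:E `^ r * \int[leb2 R]_x
    (\int[leb2 R]_y ((K (x.1 - y.1, x.2 - y.2)%R)%:E * g y)) `^ r)).
  rewrite -ge0_integralZl//; last 3 first.
  - exact: mp.
  - by move=> x _; exact: poweR_ge0.
  - exact: poweR_ge0.
  apply: ge0_le_integral => //.
  - by move=> x _; exact: poweR_ge0.
  - apply: mp; apply: measurableT_comp => //; exact/measurable_EFinP.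
  - by apply: emeasurable_funM => //; exact: mp.
  - move=> x _; rewrite -poweRM ?lee_fin//.
    by apply: lee_poweR; [exact: ltW|exact: abse_ge0|exact: Dg].
apply: lee_wpmul2l; first exact: poweR_ge0.
apply: le_trans (young g r r1 mg g0) _.
rewrite le_eqVlt; apply/orP; left; apply/eqP.
by apply: eq_integral => x _; rewrite gee0_abs.
Qed.

End Young.

(** A crude triangle inequality, for functions that may take infinite values. One factor 2 comes
    from [(a + b)^r <= 2^r (a^r + b^r)], the other from [M^r + M^r <= 2^r M^r]. *)
Lemma Lnorm_add_le d (T : measurableType d) (R : realType)
    (mu : {measure set T -> \bar R}) (g h : T -> \bar R) (r : R) (M : \bar R) :
  (1 <= r)%R -> measurable_fun setT g -> measurable_fun setT h ->
  (forall x, 0 <= g x)%E -> (forall x, 0 <= h x)%E ->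
  ('N[mu]_r%:E[g] <= M)%E -> ('N[mu]_r%:E[h] <= M)%E ->
  ('N[mu]_r%:E[g \+ h] <= 4%:E * M)%E.
Proof.
move=> r1 mg mh g0 h0 gM hM.
have r0 : (0 < r)%R by lra.
have M0 : (0 <= M)%E by apply: le_trans gM; exact: Lnorm_ge0.
have mp (u : T -> \bar R) : measurable_fun setT u ->
    measurable_fun setT (fun x => u x `^ r)%E.
  exact: (measurableT_comp (measurable_poweR r)).
have powadd (a b : \bar R) : (0 <= a)%E -> (0 <= b)%E ->
    ((a + b) `^ r <= 2%:E `^ r * (a `^ r + b `^ r))%E.
  wlog ab : a b / (a <= b)%E.
    move=> H a0 b0; have [ab|/ltW ba] := leP a b; first exact: H.
    by rewrite addeC [X in (_ * X)%E]addeC H.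
  move=> a0 b0; apply: (@le_trans _ _ ((2%:E * b) `^ r)%E).
    apply: lee_poweR; rewrite ?(ltW r0) ?adde_ge0//.
    by rewrite -[2]/(1 + 1)%R EFinD ge0_muleDl// mul1e leeD2r.
  rewrite poweRM//; apply: lee_wpmul2l; first exact: poweR_ge0.
  by rewrite leeDr ?poweR_ge0.
have NP (u : T -> \bar R) : measurable_fun setT u -> (forall x, 0 <= u x)%E ->
    ('N[mu]_r%:E[u] <= M)%E -> (\int[mu]_x (u x `^ r) <= M `^ r)%E.
  move=> mu' u0 uM; apply: (le_trans _ (lee_poweR _ _ _ _ (ltW r0) (Lnorm_ge0 _ _ _) uM)).
  rewrite poweR_Lnorm ?gt_eqF//.
  by under [leRHS]eq_integral do rewrite gee0_abs//.
have twoE : (4%:E * M = ((2%:E `^ r * (2%:E `^ r * M `^ r)) `^ r^-1))%E.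
  rewrite !poweRM ?mule_ge0 ?poweR_ge0// -!poweRrM !mulfV ?gt_eqF// !poweRe1//.
  by rewrite muleA -EFinM; congr (_%:E * _)%E; ring.
rewrite unlock twoE; apply: lee_poweR; first by rewrite invr_ge0 ltW.
  by apply: integral_ge0 => x _; exact: poweR_ge0.
apply: (@le_trans _ _ (\int[mu]_x (2%:E `^ r * (g x `^ r + h x `^ r)))%E).
  apply: ge0_le_integral => //.
  - by move=> x _; exact: poweR_ge0.
  - by apply: mp; apply: measurableT_comp => //; exact: emeasurable_funD.
  - by apply: emeasurable_funM => //; apply: emeasurable_funD; exact: mp.
  - by move=> x _; rewrite gee0_abs ?adde_ge0//; exact: powadd.
rewrite ge0_integralZl//; last 3 first.
- by apply: emeasurable_funD; exact: mp.
- by move=> x _; rewrite adde_ge0 ?poweR_ge0.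
- exact: poweR_ge0.
apply: lee_wpmul2l; first exact: poweR_ge0.
rewrite ge0_integralD; first last.
- exact: mp.
- by move=> x _; exact: poweR_ge0.
- exact: mp.
- by move=> x _; exact: poweR_ge0.
- exact: measurableT.
apply: (@le_trans _ _ (M `^ r + M `^ r)%E).
  by apply: leeD; exact: NP.
rewrite -[X in (X + X)%E]mul1e -ge0_muleDl// lee_wpmul2r ?poweR_ge0//.
rewrite poweR_EFin -EFinD lee_fin.
rewrite -[leLHS](@powRr1 _ (1 + 1)) ?addr_ge0//.
by apply: ler_powR => //; lra.
Qed.

(** * Convolutions of projections *)

Section Projection.
Context {R : realType}.
Local Open Scope ereal_scope.

(** Extended real valued, since integrability of [h] on the space makes this integral finite only on
    almost every line. Its L^r norm is the mixed norm for the horizontal plane. *)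
Definition absproj (h : R3 R -> R) (x : R2 R) : \bar R :=
  \int[leb1 R]_z `|h (x, z)|%:E.

Lemma absproj_ge0 h x : 0 <= absproj h x.
Proof. by apply: integral_ge0 => z _; rewrite lee_fin. Qed.

Lemma measurable_absproj (h : R3 R -> R) :
  measurable_fun setT h -> measurable_fun setT (absproj h).
Proof.
move=> mh.
have m : measurable_fun setT (fun z : R3 R => `|h z|%:E).
  by apply/measurable_EFinP; exact: measurableT_comp.
have h0 (z : R3 R) : 0 <= `|h z|%:E by rewrite lee_fin.
exact: (@measurable_fun_fubini_tonelli_F _ _ _ _ R (@lebesgue_measure R) _ m h0).
Qed.

Lemma abse_fine_le (x : \bar R) : `|fine x|%:E <= `|x|.
Proof. by case: x => [x| |] /=; rewrite ?leey ?normr0 ?lee_fin. Qed.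

Lemma normr_proj_xy_le (h : R3 R -> R) x : measurable_fun setT h ->
  `|proj_xy h x|%:E <= absproj h x.
Proof.
move=> mh; rewrite /proj_xy /Rintegral.
apply: (le_trans (abse_fine_le _)); apply: le_abse_integral => //.
apply/measurable_EFinP; apply: (measurableT_comp mh).
exact: pair1_measurable.
Qed.

Lemma integrable_proj_xy (h : R3 R -> R) :
  (leb3 R).-integrable setT (EFin \o h) ->
  (leb2 R).-integrable setT (EFin \o proj_xy h).
Proof.
move=> ih.
have iF := @integrable_fubini_F _ _ _ _ R leb2_sf (@lebesgue_measure R) (EFin \o h) ih.
apply: (le_integrable measurableT _ _ iF).
  apply/measurable_EFinP; apply: (measurableT_comp (fine_measurable measurableT)).
  exact: measurable_int iF.
by move=> x _; exact: abse_fine_le.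
Qed.

(** Fubini for the integrable function [k y.1 * h y], the boundedness of [k] giving integrability.
    On almost every line [h] is integrable, and there the constant [k y] comes out of the
    integral. *)
Lemma integral_proj_xy (h : R3 R -> R) (k : R2 R -> R) :
  measurable_fun setT k -> [bounded k x | x in setT] ->
  (leb3 R).-integrable setT (EFin \o h) ->
  \int[leb2 R]_y (k y * proj_xy h y)%:E = \int[leb3 R]_y (k y.1 * h y)%:E.
Proof.
move=> mk bk ih.
have mk1 : measurable_fun setT (fun y : R3 R => k y.1).
  by apply: (measurableT_comp mk); exact: measurable_fst.
have bk1 : [bounded k y.1 | y in (setT : set (R3 R))].
  case: bk => N [Nr HN]; exists N; split => // x /HN H y _.
  exact: H.
have ikh : (leb3 R).-integrable setT (fun y => (k y.1 * h y)%:E).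
  exact: (integrableMr measurableT mk1 bk1 ih).
have E := @integral12_prod_meas1 _ _ _ _ R leb2_sf (@lebesgue_measure R) _ ikh.
transitivity (\int[leb2 R]_x \int[leb1 R]_z (k x * h (x, z))%:E); last exact: E.
have ae1 := @ae_integrable1 _ _ _ _ R leb2_sf (@lebesgue_measure R) (EFin \o h) ih.
apply: ae_eq_integral => //.
- apply/measurable_EFinP/measurable_funM => //.
  apply/measurable_EFinP; exact: measurable_int (integrable_proj_xy h ih).
- exact: (@measurable_fubini_F _ _ _ _ R leb2_sf (@lebesgue_measure R) _ ikh).
apply: filterS ae1 => y iy _.
under [RHS]eq_integral do rewrite EFinM.
rewrite integralZl// EFinM; congr (_ * _).
by rewrite /proj_xy /Rintegral fineK//; exact: integrable_fin_num.
Qed.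

Lemma integral_tilt (a b c : R) (F : R3 R -> \bar R) :
  (a ^+ 2 + b ^+ 2 + c ^+ 2 = 1)%R -> (1 + c != 0)%R ->
  measurable_fun setT F ->
  \int[leb3 R]_x F (tilt a b c x) = \int[leb3 R]_x F x.
Proof.
move=> abc c1 mF; rewrite integralE [RHS]integralE.
congr (_ - _).
  rewrite -(ge0_integral_tilt a b c F^\+)//.
    by apply: eq_integral => x _; rewrite funepos_comp.
  exact: measurable_funepos.
rewrite -(ge0_integral_tilt a b c F^\-)//.
  by apply: eq_integral => x _; rewrite funeneg_comp.
exact: measurable_funeneg.
Qed.

Lemma measurable_conv2 (K u : R2 R -> R) :
  measurable_fun setT K -> (forall x, (0 <= K x)%R) -> measurable_fun setT u ->
  measurable_fun setT (conv2 K u).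
Proof.
move=> mK K0 mu.
have m0 : measurable_fun setT (fun x : R2 R =>
   \int[leb2 R]_y (K (x.1 - y.1, x.2 - y.2)%R * u y)%:E).
  have -> : (fun x : R2 R => \int[leb2 R]_y (K (x.1 - y.1, x.2 - y.2)%R * u y)%:E) =
    (fun x : R2 R => \int[leb2 R]_y ((K (x.1 - y.1, x.2 - y.2)%R)%:E * (EFin \o u)^\+ y)) \-
    (fun x : R2 R => \int[leb2 R]_y ((K (x.1 - y.1, x.2 - y.2)%R)%:E * (EFin \o u)^\- y)).
    apply/funext => x; rewrite [LHS]integralE; congr (_ - _).
      apply: eq_integral => y _; rewrite !funeposE/= -!EFin_max -EFinM.
      by rewrite maxr_pMr// mulr0.
    apply: eq_integral => y _; rewrite !funenegE/= -!EFin_max -EFinM.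
    by rewrite maxr_pMr// mulr0 mulrN.
  by apply: emeasurable_funB; apply: measurable_ge0_convolution => //;
    [apply: measurable_funepos|apply: measurable_funeneg]; exact/measurable_EFinP.
exact: (measurableT_comp (fine_measurable measurableT) m0).
Qed.

Lemma ge0_le_bounded (T : Type) (k : T -> R) (B : R) :
  (forall x, (0 <= k x)%R) -> (forall x, (k x <= B)%R) ->
  [bounded k x | x in setT].
Proof.
move=> k0 kB; exists B; split; first exact: num_real.
by move=> N BN x _; rewrite /= ger0_norm// (le_trans (kB x))// ltW.
Qed.

(** * Smoothed difference of a projection and its tilted copy *)

Section TiltedDifference.
Variables (a b c : R) (f : R3 R -> R).
Hypotheses (abc : (a ^+ 2 + b ^+ 2 + c ^+ 2 = 1)%R) (c1 : (1 + c != 0)%R).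
Hypothesis mf : measurable_fun setT f.
Hypothesis intf : (leb3 R).-integrable setT (EFin \o f).

Lemma integrable_comp_tilt :
  (leb3 R).-integrable setT (EFin \o (f \o tilt a b c)).
Proof.
have mt := @measurable_tilt R a b c.
apply/integrableP; split.
  by apply/measurable_EFinP; exact: (measurableT_comp mf mt).
rewrite (ge0_integral_tilt a b c (fun x => `|(EFin \o f) x|))//.
  by case/integrableP : intf.
by apply: measurableT_comp => //; exact/measurable_EFinP.
Qed.

(** The change of variables moves the rotation from [f], which has no regularity, to the kernel,
    where smoothness can be exploited. *)
Lemma normr_conv2_proj_tilt_le (K : R2 R -> R) (B : R) (x : R2 R) :
  measurable_fun setT K -> (forall y, (0 <= K y)%R) -> (forall y, (K y <= B)%R) ->
  `|conv2 K (fun y => proj_xy f y - proj_xy (f \o tilt a b c) y)%R x|%:E <=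
  \int[leb3 R]_y `|(K (x.1 - y.1.1, x.2 - y.1.2) -
    K (x.1 - (tilt (- a) (- b) c y).1.1, x.2 - (tilt (- a) (- b) c y).1.2)) * f y|%:E.
Proof.
move=> mK K0 KB.
pose k (y : R2 R) := K (x.1 - y.1, x.2 - y.2)%R.
have mk : measurable_fun setT k by exact: measurable_translate.
have bk : [bounded k y | y in setT].
  exact: (ge0_le_bounded _ k B (fun y => K0 _) (fun y => KB _)).
have mt' := @measurable_tilt R (- a) (- b) c.
have mk1 : measurable_fun setT (fun y : R3 R => k y.1).
  by apply: (measurableT_comp mk); exact: measurable_fst.
have mk2 : measurable_fun setT (fun y : R3 R => k (tilt (- a) (- b) c y).1).
  exact: (measurableT_comp mk1 mt').
have bk1 : [bounded k y.1 | y in (setT : set (R3 R))].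
  exact: (ge0_le_bounded _ _ B (fun y => K0 _) (fun y => KB _)).
have bk2 : [bounded k (tilt (- a) (- b) c y).1 | y in (setT : set (R3 R))].
  exact: (ge0_le_bounded _ _ B (fun y => K0 _) (fun y => KB _)).
have i2 := integrable_comp_tilt.
have ip h : (leb3 R).-integrable setT (EFin \o h) ->
    (leb2 R).-integrable setT (fun y => (k y * proj_xy h y)%:E).
  by move=> ih; exact: (integrableMr measurableT mk bk (integrable_proj_xy h ih)).
have if1 : (leb3 R).-integrable setT (fun y => (k y.1 * f y)%:E).
  exact: (integrableMr measurableT mk1 bk1 intf).
have if2 : (leb3 R).-integrable setT
    (fun y => (k (tilt (- a) (- b) c y).1 * f y)%:E).
  exact: (integrableMr measurableT mk2 bk2 intf).
have E : \int[leb2 R]_y (k y * (proj_xy f y - proj_xy (f \o tilt a b c) y))%:E =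
    \int[leb3 R]_y ((k y.1 - k (tilt (- a) (- b) c y).1) * f y)%:E.
  under eq_integral do rewrite mulrBr EFinB.
  rewrite integralB; [|exact: measurableT|exact: ip|exact: ip].
  rewrite !integral_proj_xy//.
  under [RHS]eq_integral do rewrite mulrBl EFinB.
  rewrite integralB//; congr (_ - _).
  (* Substituting [tilt a b c y] for [y] cancels the opposite tilt inside the kernel and lets the
     rotation fall on [f]. *)
  rewrite -(integral_tilt a b c (fun y => (k (tilt (- a) (- b) c y).1 * f y)%:E))//.
    apply: eq_integral => y _; cbv beta.
    have := @tiltK R (- a) (- b) c y; rewrite !opprK !sqrrN.
    by move=> ->.
  exact: (measurable_int _ if2).
rewrite /conv2 /Rintegral E.
apply: (le_trans (abse_fine_le _)).
apply: le_abse_integral => //.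
apply/measurable_EFinP/measurable_funM => //; exact: measurable_funB.
Qed.

Lemma ge0_integral_kernel_absproj (K : R2 R -> R) (h : R3 R -> R) (x : R2 R) :
  measurable_fun setT K -> (forall y, (0 <= K y)%R) -> measurable_fun setT h ->
  \int[leb3 R]_y (K (x.1 - y.1.1, x.2 - y.1.2)%R * `|h y|)%:E =
  \int[leb2 R]_y ((K (x.1 - y.1, x.2 - y.2)%R)%:E * absproj h y).
Proof.
move=> mK K0 mh.
have mk : measurable_fun setT (fun y : R3 R => K (x.1 - y.1.1, x.2 - y.1.2)%R).
  apply: (measurableT_comp (measurable_translate K mK x)).
  exact: measurable_fst.
rewrite leb3_fubini1; last 2 first.
- apply/measurable_EFinP/measurable_funM => //; exact: measurableT_comp.
- by move=> y; rewrite lee_fin mulr_ge0.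
apply: eq_integral => y _ /=.
under eq_integral do rewrite EFinM.
rewrite ge0_integralZl//.
- apply/measurable_EFinP/measurableT_comp => //; apply: (measurableT_comp mh).
  exact: pair1_measurable.
- by rewrite lee_fin.
Qed.

Lemma normr_conv2_le (K : R2 R -> R) (u w : R2 R -> R) (g h : R2 R -> \bar R) x :
  measurable_fun setT K -> (forall y, (0 <= K y)%R) ->
  measurable_fun setT u -> measurable_fun setT w ->
  measurable_fun setT g -> measurable_fun setT h ->
  (forall y, `|u y|%:E <= g y) -> (forall y, `|w y|%:E <= h y) ->
  `|conv2 K (fun y => u y - w y)%R x|%:E <=
  \int[leb2 R]_y ((K (x.1 - y.1, x.2 - y.2)%R)%:E * (g y + h y)).
Proof.
move=> mK K0 mu mw mg mh ug wh.
have mk := measurable_translate K mK x.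
rewrite /conv2 /Rintegral; apply: (le_trans (abse_fine_le _)).
have mI : measurable_fun setT
    (fun y : R2 R => (K (x.1 - y.1, x.2 - y.2) * (u y - w y))%:E)%R.
  by apply/measurable_EFinP/measurable_funM => //; exact: measurable_funB.
apply: (le_trans (le_abse_integral _ measurableT mI)).
apply: ge0_le_integral => //.
- exact: measurableT_comp.
- apply: emeasurable_funM; first exact/measurable_EFinP.
  exact: emeasurable_funD.
- move=> y _; rewrite /= normrM EFinM ger0_norm//; apply: lee_wpmul2l.
    by rewrite lee_fin.
  apply: le_trans (leeD (ug y) (wh y)).
  by rewrite -EFinD lee_fin ler_normB.
Qed.

(** The estimate at a single scale; [M] bounds the mixed norms of [f] for the horizontal plane and
    for the tilted one. *)
Lemma Lnorm_conv2_gauss2_le (tau d r : R) (M : \bar R) :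
  (0 < tau)%R -> (0 <= d)%R -> (1 <= r)%R ->
  (forall y, f y != 0%R ->
    let y' := tilt (- a) (- b) c y in
    (enorm2 (y.1.1 - y'.1.1, y.1.2 - y'.1.2) <= d)%R) ->
  'N[leb2 R]_r%:E[absproj f] <= M ->
  'N[leb2 R]_r%:E[absproj (f \o tilt a b c)] <= M ->
  'N[leb2 R]_r%:E[EFin \o conv2 (gauss2 tau)
      (fun y => proj_xy f y - proj_xy (f \o tilt a b c) y)%R]
    <= (64 * Num.min 1 (d / Num.sqrt tau))%:E * M.
Proof.
move=> t0 d0 r1 fd N1 N2.
have s0 : (0 < Num.sqrt tau)%R by rewrite sqrtr_gt0.
have M0 : 0 <= M by apply: le_trans N1; exact: Lnorm_ge0.
have mg := @measurable_gauss2 R.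
have mp h : (leb3 R).-integrable setT (EFin \o h) -> measurable_fun setT (proj_xy h).
  by move=> ih; apply/measurable_EFinP; exact: measurable_int (integrable_proj_xy h ih).
have i2 := integrable_comp_tilt.
have mf2 : measurable_fun setT (f \o tilt a b c).
  exact: (measurableT_comp mf (measurable_tilt a b c)).
have mD : measurable_fun setT (conv2 (gauss2 tau)
    (fun y => proj_xy f y - proj_xy (f \o tilt a b c) y)%R).
  apply: measurable_conv2 => //; first by move=> x; exact: gauss2_ge0.
  by apply: measurable_funB; exact: mp.
have ma1 := measurable_absproj f mf; have ma2 := measurable_absproj _ mf2.
(* For [d] at most [sqrt tau] the two kernels nearly cancel and Young's inequality is applied at
   scale [4 tau]; otherwise the two projections are bounded separately. *)
have [dt|td] := leP d (Num.sqrt tau).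
  rewrite min_r; last by rewrite ler_pdivrMr// mul1r.
  have t4 : (0 < 4 * tau)%R by rewrite mulr_gt0.
  have dt2 : (d ^+ 2 <= tau)%R.
    by rewrite -(sqr_sqrtr (ltW t0)) ler_sqr ?nnegrE// ltW.
  have C0 : (0 <= 64 * (d / Num.sqrt tau))%R by rewrite mulr_ge0 ?divr_ge0 ?(ltW s0).
  apply: (@le_trans _ _ ((64 * (d / Num.sqrt tau))%:E * 'N[leb2 R]_r%:E[absproj f])); last first.
    by apply: lee_wpmul2l; rewrite ?lee_fin.
  apply: (Lnorm_le_young (gauss2 (4 * tau))) => //.
  - by move=> x; exact: gauss2_ge0.
  - exact: integral_gauss2.
  - by move=> z w; exact: gauss2N.
  - exact: absproj_ge0.
  move=> x.
  apply: le_trans (@normr_conv2_proj_tilt_le (gauss2 tau) (pi * tau)^-1 x _ _ _) _ => //.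
  - by move=> y; exact: gauss2_ge0.
  - by move=> y; exact: gauss2_le.
  have mk t : measurable_fun setT (fun y : R3 R => gauss2 t (x.1 - y.1.1, x.2 - y.1.2)%R).
    apply: (measurableT_comp (measurable_translate _ (mg t) x)).
    exact: measurable_fst.
  have g40 y : (0 <= gauss2 (4 * tau) y)%R by exact: gauss2_ge0.
  rewrite -ge0_integral_kernel_absproj// -ge0_integralZl//; last 2 first.
  + by apply/measurable_EFinP/measurable_funM => //; exact: measurableT_comp.
  + by move=> y _; rewrite lee_fin mulr_ge0.
  apply: ge0_le_integral => //.
  - apply/measurable_EFinP; apply: measurableT_comp => //; apply: measurable_funM => //.
    apply: measurable_funB => //.
    exact: (measurableT_comp (mk tau) (measurable_tilt (- a) (- b) c)).
  - apply: emeasurable_funM => //; apply/measurable_EFinP/measurable_funM => //.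
    exact: measurableT_comp.
  move=> y _; rewrite -EFinM lee_fin normrM.
  (* Both sides vanish where [f] does, so the displacement matters only where [f] is nonzero. *)
  have [->|fy] := eqVneq (f y) 0%R; first by rewrite normr0 !mulr0.
  rewrite [leRHS]mulrA ler_wpM2r//.
  apply: gauss2_lipschitz => //=.
  have -> : enorm2 (x.1 - y.1.1 - (x.1 - (tilt (- a) (- b) c y).1.1),
      x.2 - y.1.2 - (x.2 - (tilt (- a) (- b) c y).1.2))%R =
      enorm2 (y.1.1 - (tilt (- a) (- b) c y).1.1, y.1.2 - (tilt (- a) (- b) c y).1.2)%R.
    rewrite /enorm2; congr Num.sqrt; cbn [fst snd]; ring.
  exact: fd.
rewrite min_l; last by rewrite ler_pdivlMr// mul1r ltW.
apply: (@le_trans _ _ (1%:E * 'N[leb2 R]_r%:E[absproj f \+ absproj (f \o tilt a b c)])).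
  apply: (Lnorm_le_young (gauss2 tau)) => //.
  - by move=> x; exact: gauss2_ge0.
  - exact: integral_gauss2.
  - by move=> z w; exact: gauss2N.
  - exact: emeasurable_funD.
  - by move=> x; rewrite adde_ge0 ?absproj_ge0.
  move=> x; rewrite mul1e.
  apply: normr_conv2_le => //; try exact: mp.
  + by move=> y; exact: gauss2_ge0.
  + by move=> y; exact: normr_proj_xy_le.
  + by move=> y; exact: normr_proj_xy_le.
rewrite mul1e mulr1.
apply: le_trans (@Lnorm_add_le _ _ _ _ _ _ _ _ r1 ma1 ma2
  (absproj_ge0 _) (absproj_ge0 _) N1 N2) _.
by apply: lee_wpmul2r => //; rewrite lee_fin; lra.
Qed.

End TiltedDifference.

End Projection.

(** * Rotations *)

Section Geometry.
Context {R : realType}.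
Implicit Types (a b c : R) (A B U : 'M[R]_3) (x y : R3 R).

Lemma col3K (v : 'cV[R]_3) : col3 (pt3 v) = v.
Proof.
by apply/matrixP => i j; rewrite ord1 mxE; case: i => [[|[|[|//]]] i3] /=;
  congr (v _ _); exact/val_inj.
Qed.

Lemma app3M A B x : app3 A (app3 B x) = app3 (A *m B) x.
Proof. by rewrite /app3 col3K mulmxA. Qed.

Lemma app3E A x : app3 A x =
  (A 0 0 * x.1.1 + A 0 1 * x.1.2 + A 0 2%:R * x.2,
   A 1 0 * x.1.1 + A 1 1 * x.1.2 + A 1 2%:R * x.2,
   A 2%:R 0 * x.1.1 + A 2%:R 1 * x.1.2 + A 2%:R 2%:R * x.2).
Proof.
have E i : (A *m col3 x) i 0 = A i 0 * x.1.1 + A i 1 * x.1.2 + A i 2%:R * x.2.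
  rewrite !mxE !big_ord_recl big_ord0 addr0 !mxE/= addrA.
  by congr (_ * _ + _ * _ + _ * _); congr (A _ _); exact/val_inj.
by rewrite /app3 /pt3 !E.
Qed.

Lemma app2E (Q : 'M[R]_2) (x : R2 R) : app2 Q x =
  (Q 0 0 * x.1 + Q 0 1 * x.2, Q 1 0 * x.1 + Q 1 1 * x.2).
Proof.
have E i : (Q *m col2 x) i 0 = Q i 0 * x.1 + Q i 1 * x.2.
  rewrite !mxE !big_ord_recl big_ord0 addr0 !mxE/=.
  by congr (_ * _ + _ * _); congr (Q _ _); exact/val_inj.
by rewrite /app2 /pt2 !E.
Qed.

Lemma app3_1 x : app3 1%:M x = x.
Proof. by rewrite app3E !mxE/= !(mul1r, mul0r, addr0, add0r); case: x => [[]]. Qed.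

Definition mx3 (a00 a01 a02 a10 a11 a12 a20 a21 a22 : R) : 'M[R]_3 :=
  \matrix_(i < 3, j < 3) nth 0 (nth [::]
    [:: [:: a00; a01; a02]; [:: a10; a11; a12]; [:: a20; a21; a22]] i) j.

Definition tilt_mx a b c : 'M[R]_3 := mx3
  (1 - a ^+ 2 / (1 + c)) (- (a * b) / (1 + c)) a
  (- (a * b) / (1 + c)) (1 - b ^+ 2 / (1 + c)) b
  (- a) (- b) c.

Lemma app3_tilt_mx a b c x : app3 (tilt_mx a b c) x = tilt a b c x.
Proof.
rewrite app3E /tilt_mx /mx3 !mxE/= /tilt.
by congr (_, _, _); ring.
Qed.

Lemma det2 (Q : 'M[R]_2) : \det Q = Q 0 0 * Q 1 1 - Q 0 1 * Q 1 0.
Proof.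
rewrite (expand_det_row Q 0) !big_ord_recl big_ord0 addr0 /cofactor !det_mx11 !mxE.
rewrite expr0 expr1 mul1r mulN1r mulrN.
by congr (_ * _ - _ * _); congr (Q _ _); exact/val_inj.
Qed.

Lemma det3 A : \det A =
  A 0 0 * (A 1 1 * A 2%:R 2%:R - A 1 2%:R * A 2%:R 1)
  - A 0 1 * (A 1 0 * A 2%:R 2%:R - A 1 2%:R * A 2%:R 0)
  + A 0 2%:R * (A 1 0 * A 2%:R 1 - A 1 1 * A 2%:R 0).
Proof.
rewrite (expand_det_row A 0) !big_ord_recl big_ord0 addr0 /cofactor !det2 !mxE.
rewrite addrA expr0 expr1 sqrrN expr1n !mul1r mulN1r mulrN.
by congr (_ * (_ * _ - _ * _) - _ * (_ * _ - _ * _) + _ * (_ * _ - _ * _));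
  congr (A _ _); exact/val_inj.
Qed.

(** The last row of [A] is a unit vector with last entry 1, so its other entries vanish. Hence [A]
    is block diagonal and its upper block inherits orthogonality and determinant 1. *)
Lemma fix_ez_block A : A *m A^T = 1%:M -> \det A = 1 ->
    A 0 2%:R = 0 -> A 1 2%:R = 0 -> A 2%:R 2%:R = 1 ->
  exists2 Q : 'M[R]_2, Q \in @SO R 2 &
    forall (x : R2 R) (z : R), app3 A (x, z) = (app2 Q x, z).
Proof.
move=> AA dA A02 A12 A22.
have E i j : A i 0 * A j 0 + A i 1 * A j 1 + A i 2%:R * A j 2%:R = (i == j)%:R.
  move/matrixP : AA => /(_ i j); rewrite !mxE !big_ord_recl big_ord0 addr0 !mxE addrA => <-.
  by congr (_ * _ + _ * _ + _ * _); congr (A _ _); exact/val_inj.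
have : A 2%:R 0 ^+ 2 + A 2%:R 1 ^+ 2 = 0.
  by have := E 2%:R 2%:R; rewrite A22 mulr1 eqxx/= -!expr2; lra.
move/eqP; rewrite paddr_eq0 ?sqr_ge0// !sqrf_eq0 => /andP[/eqP A20 /eqP A21].
pose Q : 'M[R]_2 := \matrix_(i < 2, j < 2)
  nth 0 (nth [::] [:: [:: A 0 0; A 0 1]; [:: A 1 0; A 1 1]] i) j.
exists Q.
  rewrite inE; split; last first.
    by rewrite det2 !mxE/= -dA det3 A02 A12 A20 A21 A22; ring.
  have E00 := E 0 0; have E01 := E 0 1; have E11 := E 1 1.
  rewrite A02 mulr0 addr0 in E00; rewrite A02 mul0r addr0 in E01.
  rewrite A12 mulr0 addr0 in E11.
  apply/matrixP => i j; rewrite !mxE !big_ord_recl big_ord0 addr0 !mxE.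
  case: i => [[|[|//]] i2]; case: j => [[|[|//]] j2] /=; rewrite ?E00 ?E01 ?E11//.
  by rewrite mulrC [X in _ + X]mulrC E01.
move=> x z; rewrite app3E app2E !mxE/= A02 A12 A20 A21 A22.
by rewrite !mul0r !add0r !addr0 mul1r.
Qed.
Lemma tilt_mx_orthogonal a b c : a ^+ 2 + b ^+ 2 + c ^+ 2 = 1 -> 1 + c != 0 ->
  (tilt_mx a b c) *m (tilt_mx a b c)^T = 1%:M.
Proof.
move=> abc c1.
set k := (1 + c)^-1%R.
have kc : (k * c = 1 - k)%R by rewrite -(mulVf c1) -/k; ring.
have s2 : (b ^+ 2 = 1 - c ^+ 2 - a ^+ 2)%R by rewrite -abc; ring.
rewrite /tilt_mx /mx3 -/k.
apply/matrixP => i j; rewrite !mxE !big_ord_recl big_ord0 !mxE.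
case: i => [[|[|[|//]]] i3]; case: j => [[|[|[|//]]] j3] /=;
  rewrite ?mulr1n ?mulr0n; ring: kc s2.
Qed.

Lemma tilt_mx_det a b c : a ^+ 2 + b ^+ 2 + c ^+ 2 = 1 -> 1 + c != 0 ->
  \det (tilt_mx a b c) = 1.
Proof.
move=> abc c1.
set k := (1 + c)^-1%R.
have kc : (k * c = 1 - k)%R by rewrite -(mulVf c1) -/k; ring.
have s2 : (b ^+ 2 = 1 - c ^+ 2 - a ^+ 2)%R by rewrite -abc; ring.
rewrite det3 /tilt_mx /mx3 -/k !mxE /=. ring: kc s2.
Qed.

(** The horizontal displacement is, up to sign, [(a, b)] times the linear form with coefficients
    [(a k, b k, 1)]. Cauchy-Schwarz leaves the factor [2 (1 - c) = 4 s^2], where [s] will be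
    [sin(theta/2)]. *)
Lemma tilt_displacement a b c rad s y :
  a ^+ 2 + b ^+ 2 + c ^+ 2 = 1 -> 1 + c != 0 ->
  0 <= rad -> 0 <= s -> 1 - c = 2 * s ^+ 2 -> enorm3 y <= rad ->
  enorm2 (y.1.1 - (tilt (- a) (- b) c y).1.1, y.1.2 - (tilt (- a) (- b) c y).1.2)
    <= 2 * rad * s.
Proof.
move=> abc c1 rad0 s0 cs yr.
case: y yr => [[x y] z] yr.
set k := (1 + c)^-1%R.
have kc : (k * c = 1 - k)%R by rewrite -(mulVf c1) -/k; ring.
have s2 : (b ^+ 2 = 1 - c ^+ 2 - a ^+ 2)%R by rewrite -abc; ring.
have yr2 : x ^+ 2 + y ^+ 2 + z ^+ 2 <= rad ^+ 2.
  move: yr; rewrite -ler_sqr ?nnegrE ?sqrtr_ge0// /enorm3 /dot3/= sqr_sqrtr//.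
  by rewrite !addr_ge0// -expr2 sqr_ge0.
rewrite -ler_sqr ?nnegrE ?sqrtr_ge0 ?mulr_ge0// /enorm2/= sqr_sqrtr; last first.
  by rewrite addr_ge0// sqr_ge0.
rewrite -/k.
have -> : (x - (x - - a * ((- a * x + - b * y) * k) + - a * z)) ^+ 2 +
   (y - (y - - b * ((- a * x + - b * y) * k) + - b * z)) ^+ 2 =
   (a ^+ 2 + b ^+ 2) * ((a * k) * x + (b * k) * y + z) ^+ 2 by ring.
have CS : ((a * k) * x + (b * k) * y + z) ^+ 2 <=
   ((a * k) ^+ 2 + (b * k) ^+ 2 + 1) * (x ^+ 2 + y ^+ 2 + z ^+ 2).
  have := sqr_ge0 ((a * k) * y - (b * k) * x).
  have := sqr_ge0 ((a * k) * z - x); have := sqr_ge0 ((b * k) * z - y).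
  set A := a * k; set B := b * k => h1 h2 h3.
  (* Lagrange's identity, which writes the Cauchy-Schwarz defect as a sum of squares. *)
  rewrite -subr_ge0; have -> : (A ^+ 2 + B ^+ 2 + 1) * (x ^+ 2 + y ^+ 2 + z ^+ 2) -
    (A * x + B * y + z) ^+ 2 =
    (A * y - B * x) ^+ 2 + (A * z - x) ^+ 2 + (B * z - y) ^+ 2 by ring.
  by rewrite !addr_ge0.
have ab0 : 0 <= a ^+ 2 + b ^+ 2 by rewrite addr_ge0// sqr_ge0.
apply: (le_trans (ler_wpM2l ab0 CS)); rewrite mulrA.
have -> : (a ^+ 2 + b ^+ 2) * ((a * k) ^+ 2 + (b * k) ^+ 2 + 1) = 2 * (1 - c).
  by ring: kc s2.
rewrite cs (_ : (2 * rad * s) ^+ 2 = 2 * (2 * s ^+ 2) * rad ^+ 2); last by ring.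
by apply: ler_wpM2l => //; rewrite !mulr_ge0 ?sqr_ge0.
Qed.

(** If column 0 were a multiple of column 1, its squared length 1 would be a multiple of their inner
    product 0. *)
Lemma dim_orthonormal_cols B : B^T *m B = 1%:M ->
  \dim <<[:: col 0 B; col 1 B]>> = 2%N.
Proof.
move=> BB.
have E i j : \sum_k B k i * B k j = (i == j)%:R.
  by move/matrixP : BB => /(_ i j); rewrite !mxE => <-; apply: eq_bigr => k _; rewrite mxE.
have cn0 : col 1 B != 0.
  apply/eqP => h; have := E 1 1; rewrite big1 ?eqxx/=.
    by move/eqP; rewrite eq_sym oner_eq0.
  move=> k _; have /matrixP/(_ k 0) := h; rewrite !mxE => ->; exact: mulr0.
apply/eqP; apply: (_ : free [:: col 0 B; col 1 B]).
rewrite free_cons seq1_free cn0 andbT span_seq1; apply/vlineP => -[k h].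
have /eqP := E 0 0; apply/negP.
have -> : \sum_i B i 0 * B i 0 = k * \sum_i B i 1 * B i 0.
  rewrite mulr_sumr; apply: eq_bigr => i _; rewrite mulrA; congr (_ * _).
  by have /matrixP/(_ i 0) := h; rewrite !mxE.
by rewrite E mulr0 eq_sym oner_eq0.
Qed.

(** An orthogonal matrix is an adapted frame of the plane spanned by its first two columns, so it
    competes in both suprema. *)
Lemma mixed_norm_in_le_max (r : R) (f : R3 R -> R) B : B^T *m B = 1%:M ->
  (mixed_norm_in r f B <= max_mixed_norm r f)%E.
Proof.
move=> BB.
apply: (@le_trans _ _ (mixed_norm r f <<[:: col 0%R B; col 1%R B]>>%VS)).
  by apply: ereal_sup_ubound; exists B.
apply: ereal_sup_ubound; exists <<[:: col 0%R B; col 1%R B]>>%VS => //.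
exact: dim_orthonormal_cols.
Qed.

End Geometry.

(** * From one scale to the distance, and the main estimate *)

Section Assembly.
Context {R : realType}.

(** With [q = sqrt omega] and [eps = d / sqrt tau0], one has [sqrt tau_k = sqrt tau0 * q^k], so the
    k-th term is at most [(A * T k)^p], where [T k] is the quantity summed in [scale_sum_le]. *)
Lemma scale_dist_le (tau0 omega alpha p r m d : R) (u w : R2 R -> R) :
  0 < alpha -> 1 <= p -> 0 < omega < 1 -> 0 < tau0 -> 0 <= m ->
  0 <= d -> d ^+ 2 <= tau0 ->
  (forall tau : R, 0 < tau ->
    ('N[leb2 R]_r%:E[EFin \o conv2 (gauss2 tau) (fun x => u x - w x)%R]
      <= (64 * Num.min 1 (d / Num.sqrt tau) * m)%:E)%E) ->
  (scale_dist tau0 omega alpha p r u w <=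
    (128 * m * (tau0 `^ (alpha / 2) / (1 - omega `^ 2^-1) *
     Delta alpha p (d / Num.sqrt tau0)))%:E)%E.
Proof.
move=> a0 p1 /andP[w0 w1] t0 m0 d0 dt2 Nle.
have p0 : 0 < p by exact: lt_le_trans p1.
set q := omega `^ 2^-1.
have qs : q = Num.sqrt omega by rewrite /q powR12_sqrt// ltW.
have q2 : q ^+ 2 = omega by rewrite qs sqr_sqrtr// ltW.
have q0 : 0 < q by rewrite powR_gt0.
have q1 : q < 1 by rewrite qs -sqrtr1 ltr_sqrt.
set eps := d / Num.sqrt tau0.
have s0 : 0 < Num.sqrt tau0 by rewrite sqrtr_gt0.
have e0 : 0 <= eps by rewrite divr_ge0// ltW.
have e1 : eps <= 1.
  by rewrite ler_pdivrMr// mul1r -ler_sqr ?nnegrE ?(ltW s0)// sqr_sqrtr// ltW.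
set A := 64 * m * tau0 `^ (alpha / 2).
have A0 : 0 <= A by rewrite !mulr_ge0// powR_ge0.
pose T k := (q ^+ k) `^ alpha * Num.min 1 (eps / q ^+ k).
have T0 k : 0 <= T k.
  by rewrite mulr_ge0 ?powR_ge0// le_min ler01 divr_ge0// exprn_ge0// ltW.
have D0 : 0 <= Delta alpha p eps by apply: Delta_ge0 => //; rewrite e0.
have term k : (((tau0 * omega ^+ k) `^ (p * alpha / 2))%:E *
    'N[leb2 R]_r%:E[EFin \o conv2 (gauss2 (tau0 * omega ^+ k))
       (fun x => u x - w x)%R] `^ p <= ((A * T k) `^ p)%:E)%E.
  have tk0 : 0 < tau0 * omega ^+ k by rewrite mulr_gt0// exprn_gt0.
  have qk0 : 0 < q ^+ k by rewrite exprn_gt0.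
  have st : Num.sqrt (tau0 * omega ^+ k) = Num.sqrt tau0 * q ^+ k.
    rewrite sqrtrM ?(ltW t0)//; congr (_ * _).
    by rewrite -q2 exprAC sqrtr_sqr ger0_norm// ltW.
  have E1 : (tau0 * omega ^+ k) `^ (p * alpha / 2) =
      (tau0 `^ (alpha / 2) * (q ^+ k) `^ alpha) `^ p.
    rewrite (_ : p * alpha / 2 = alpha / 2 * p); last by ring.
    rewrite powRrM; congr (_ `^ p).
    rewrite powRM; [|exact: ltW|by rewrite exprn_ge0// ltW].
    congr (_ * _); rewrite -q2 exprAC -powR_mulrn; last exact: ltW.
    by rewrite -powRrM; congr powR; field.
  apply: (@le_trans _ _ (((tau0 * omega ^+ k) `^ (p * alpha / 2))%:E *
     (64 * Num.min 1 (d / Num.sqrt (tau0 * omega ^+ k)) * m)%:E `^ p)%E).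
    apply: lee_wpmul2l; first by rewrite lee_fin powR_ge0.
    by apply: lee_poweR; rewrite ?(ltW p0) ?Lnorm_ge0//; exact: Nle.
  rewrite poweR_EFin -EFinM lee_fin E1 st.
  have -> : d / (Num.sqrt tau0 * q ^+ k) = eps / q ^+ k by rewrite invfM mulrA.
  have m0' : 0 <= Num.min 1 (eps / q ^+ k).
    by rewrite le_min ler01 divr_ge0// ltW.
  rewrite -powRM ?mulr_ge0 ?powR_ge0// le_eqVlt; apply/orP; left; apply/eqP.
  by congr powR; rewrite /A /T; ring.
rewrite /scale_dist.
set B := 2 * Delta alpha p eps / (1 - q).
have B0 : 0 <= B by rewrite divr_ge0 ?mulr_ge0// subr_ge0 ltW.
apply: (@le_trans _ _ ((((A * B) `^ p)%:E) `^ p^-1)%E).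
  apply: lee_poweR; first by rewrite invr_ge0 ltW.
    by apply: nneseries_ge0 => k _ _; rewrite mule_ge0 ?poweR_ge0// lee_fin powR_ge0.
  apply: (@le_trans _ _ (\sum_(0 <= k <oo) ((A * T k) `^ p)%:E)%E).
    apply: lee_nneseries => k _; last exact: term.
    by rewrite mule_ge0 ?poweR_ge0// lee_fin powR_ge0.
  (* The bound on the partial sums is uniform in [n], hence passes to the series. *)
  apply: lime_le.
    by apply: is_cvg_nneseries => k _ _; rewrite lee_fin powR_ge0.
  apply: nearW => n; rewrite sumEFin lee_fin big_mkord.
  under eq_bigr do rewrite powRM//.
  rewrite -mulr_sumr powRM// ler_wpM2l ?powR_ge0//.
  by apply: scale_sum_le => //; [rewrite q0|rewrite e0].
rewrite poweR_EFin -powRrM mulfV ?gt_eqF// powRr1; last exact: mulr_ge0.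
rewrite lee_fin le_eqVlt; apply/orP; left; apply/eqP.
by rewrite /A /B; field; rewrite subr_eq0 gt_eqF.
Qed.

End Assembly.

Theorem theorem4p7 (R : realType) :
  exists C : R, 0 < C /\
  forall (alpha p r omega tau0 rad : R),
    0 < alpha -> 1 <= p -> 1 <= r -> 0 < omega < 1 -> 0 < tau0 -> 0 < rad ->
  forall (U : 'M[R]_3) (theta : R),
    U \in @SO R 3 ->
    theta = angle3 ez (app3 U ez) -> 0 <= theta < pi ->
  forall f : R3 R -> R,
    f \in Lfun (leb3 R) 1%E -> f \in Lfun (leb3 R) r%:E ->
    (max_mixed_norm r f < +oo)%E ->
    (forall x : R3 R, rad < enorm3 x -> f x = 0) ->
    (2 * rad * sin (theta / 2)) ^+ 2 <= tau0 ->
  (scale_dist_SO2 tau0 omega alpha p r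
     (proj_xy f) (proj_xy (fun x => f (app3 U x)))
   <= C%:E * max_mixed_norm r f *
      (tau0 `^ (alpha / 2) / (1 - omega `^ 2^-1) *
       Delta alpha p (2 * rad * sin (theta / 2) / Num.sqrt tau0))%:E)%E.
Proof.
(* [128 = 64 * 2]: the factor 64 comes from the estimate at one scale, the factor 2 from the sum
   over scales. *)
exists 128; split => // alpha p r omega tau0 rad a0 p1 r1 o01 t0 rad0 U theta.
rewrite inE => -[UU dU] thetaE /andP[th0 thpi] f f1 _ Mlty fsupp dtau.
set a := U 0 2%:R; set b := U 1 2%:R; set c := U 2%:R 2%:R.
have UtU := mulmx1C UU.
have colU i j : U 0 i * U 0 j + U 1 i * U 1 j + U 2%:R i * U 2%:R j = (i == j)%:R.
  move/matrixP : UtU => /(_ i j); rewrite !mxE !big_ord_recl big_ord0 addr0 !mxE addrA => <-.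
  by congr (_ * _ + _ * _ + _ * _); congr (U _ _); exact/val_inj.
have abc : a ^+ 2 + b ^+ 2 + c ^+ 2 = 1 by have := colU 2%:R 2%:R; rewrite eqxx -!expr2.
have vE : app3 U ez = (a, b, c).
  by rewrite app3E/= !mulr0 !add0r !mulr1.
have thc : theta = acos c.
  rewrite thetaE /angle3 vE /enorm3 /dot3 /ez/= !mul0r !add0r !mul1r -!expr2 abc.
  by rewrite sqrtr1 mulr1 invr1 mulr1.
have c2 : -1 <= c <= 1.
  by have a2 := sqr_ge0 a; have b2 := sqr_ge0 b; apply/andP; split; nra.
have cth : cos theta = c by rewrite thc acosK// in_itv.
(* [theta < pi] excludes [v = - e_z], where no minimal rotation is singled out. *)
have c1 : 1 + c != 0.
  apply/eqP => h; have cN1 : c = -1 by lra.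
  by move: thpi; rewrite thc cN1 acosN1 ltxx.
set s := sin (theta / 2).
have s0 : 0 <= s by apply: sin_ge0_pi; apply/andP; split; lra.
have cs : 1 - c = 2 * s ^+ 2.
  rewrite -cth {1}(_ : theta = (theta / 2) *+ 2); last by rewrite -mulr_natr; field.
  by rewrite cos_mulr2n /s sin2cos2 -mulr_natr; ring.
set V := tilt_mx a b c.
have VV := tilt_mx_orthogonal a b c abc c1.
have dV := tilt_mx_det a b c abc c1.
(* [U] and [V] both send [e_z] to [v], so [W] fixes [e_z] and acts as a plane rotation [Q] on
   horizontal coordinates; [U W = V] is what makes [(P f_U) o Q] equal to [P f_V]. *)
pose W := U^T *m V.
have WW : W *m W^T = 1%:M.
  by rewrite trmx_mul trmxK mulmxA -(mulmxA U^T) VV mulmx1.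
have dW : \det W = 1 by rewrite det_mulmx det_tr dU dV mulr1.
have Wi2 i : W i 2%:R = (i == 2%:R)%:R.
  rewrite -colU !mxE !big_ord_recl big_ord0 addr0 !mxE/= addrA.
  by congr (_ * _ + _ * _ + _ * _); congr (U _ _); exact/val_inj.
have [Q QSO QE] := fix_ez_block W WW dW (Wi2 0) (Wi2 1) (Wi2 2%:R).
have UQ (x : R2 R) (z : R) : app3 U (app2 Q x, z) = tilt a b c (x, z).
  by rewrite -QE app3M /W mulmxA UU mul1mx app3_tilt_mx.
have intf : (leb3 R).-integrable setT (EFin \o f) by exact/Lfun1_integrable.
have mf : measurable_fun setT f by apply/measurable_EFinP; exact: measurable_int intf.
(* The two planes needed are the horizontal one, with the identity as frame, and its image under
   [V], with [V] as frame. *)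
have N1 : ('N[leb2 R]_r%:E[absproj f] <= max_mixed_norm r f)%E.
  have := @mixed_norm_in_le_max R r f 1%:M; rewrite trmx1 mulmx1 => /(_ erefl).
  rewrite /mixed_norm_in; under eq_Lnorm => x do under eq_integral do rewrite app3_1.
  by [].
have N2 : ('N[leb2 R]_r%:E[absproj (f \o tilt a b c)] <= max_mixed_norm r f)%E.
  have := @mixed_norm_in_le_max R r f V (mulmx1C VV).
  rewrite /mixed_norm_in; under eq_Lnorm => x do under eq_integral do rewrite app3_tilt_mx.
  by [].
have M0 : (0 <= max_mixed_norm r f)%E by apply: le_trans N1; exact: Lnorm_ge0.
set M := max_mixed_norm r f in Mlty N1 N2 M0 *.
have Mfin : M = (fine M)%:E by rewrite fineK// ge0_fin_numE.
have fd y : f y != 0 -> enorm2 (y.1.1 - (tilt (- a) (- b) c y).1.1,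
    y.1.2 - (tilt (- a) (- b) c y).1.2) <= 2 * rad * s.
  move=> fy; apply: tilt_displacement => //; first exact: ltW.
  by rewrite leNgt; apply: contra fy => /fsupp ->.
(* The infimum over SO(2) is bounded by the value at [Q]. *)
apply: (@le_trans _ _ (scale_dist tau0 omega alpha p r (proj_xy f)
    (proj_xy (f \o tilt a b c)))).
  apply: ereal_inf_lbound; exists Q; first exact: set_mem.
  congr scale_dist; apply/funext => x /=; rewrite /proj_xy.
  by apply: eq_Rintegral => z _ /=; rewrite UQ.
have s2 : 0 <= 2 * rad * s by rewrite !mulr_ge0// ltW.
have Nle tau : 0 < tau -> ('N[leb2 R]_r%:E[EFin \o conv2 (gauss2 tau)
    (fun x => proj_xy f x - proj_xy (f \o tilt a b c) x)%R]
    <= (64 * Num.min 1 (2 * rad * s / Num.sqrt tau) * fine M)%:E)%E.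
  by move=> tau_gt0; rewrite EFinM -Mfin; exact: Lnorm_conv2_gauss2_le.
have := scale_dist_le tau0 omega alpha p r (fine M) (2 * rad * s) _ _
  a0 p1 o01 t0 (fine_ge0 M0) s2 dtau Nle.
by rewrite EFinM [(128 * fine M)%:E]EFinM -Mfin.
Qed.
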